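(* Let $n\ge 1$ be an integer and let $\boldsymbol p=(p(j))_{j\ge1}$ be a sequence with $p(j)\in[0,\tfrac12]$ and $p(j)\ge p(j+1)$ for all $j\ge1$. Let $\Delta_n(\boldsymbol p)$ be the expected maximal deviation for the product Bernoulli distribution with parameters $\boldsymbol p$, and let $\phi_{J,q}(n)$ be the function defined in the context. Then, with universal constants in all the relations $\asymp$: (i) If $p(j)\le \frac{1}{2nj}$ for all $j\ge 1$, then $\Delta_n(\boldsymbol p)\asymp \frac1n\wedge\sum_{j\ge1}p(j)$. (ii) Otherwise, $$\Delta_n(\boldsymbol p)\asymp \sup_{j\ge1}\phi_{j,p(j)}(n)\asymp 1\wedge\sup_{j\ge1}\left(\sqrt{\frac{p(j)\ln(j+1)}{n}}\vee\frac{\ln(j+1)}{n\ln\left(2+\frac{\ln(j+1)}{np(j)}\right)}\right).$$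
   Context: Notation: $a\vee b=\max(a,b)$, $a\wedge b=\min(a,b)$. $A\asymp B$ means that there are universal constants $0<c\le C$ (independent of $n$, $\boldsymbol p$ and all other parameters) with $cB\le A\le CB$. Given $\boldsymbol p$, let $\mu$ be the product distribution on $\{0,1\}^{\mathbb N}$ under which the coordinates $X(j)$ are independent Bernoulli variables with parameters $p(j)$. Let $X_1,\dots,X_n$ be i.i.d. samples from $\mu$, $\hat{\boldsymbol p}_n=\frac1n\sum_{i=1}^nX_i$, and $\Delta_n(\boldsymbol p)=\mathbb E\|\hat{\boldsymbol p}_n-\boldsymbol p\|_\infty=\mathbb E\sup_{j\ge1}|\hat p_n(j)-p(j)|$. For integers $n,J\ge1$ and $q\in(0,\frac12]$ define $$\phi_{J,q}(n)=\begin{cases}1 & n\le\frac{\ln(J+1)}{\ln(1/q)},\\ \frac{\ln(J+1)}{n\ln\frac{\ln(J+1)}{nq}} & \frac{\ln(J+1)}{\ln(1/q)}\le n\le\frac{\ln(J+1)}{eq},\\ \sqrt{\frac{q\ln(J+1)}{n}} & n\ge\frac{\ln(J+1)}{eq},\end{cases}$$ where the first applicable case is used if the conditions overlap, and $\phi_{J,0}(n)=0$. When $p(j)=0$ the term $\frac{\ln(j+1)}{n\ln(2+\ln(j+1)/(np(j)))}$ is interpreted as $0$. *)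

(* Defs.v *)
From HB Require Import structures.
From mathcomp Require Import all_boot all_order all_algebra.
From mathcomp Require Import all_classical all_reals all_analysis.

Set Implicit Arguments.
Unset Strict Implicit.
Unset Printing Implicit Defensive.

Import Order.TTheory GRing.Theory Num.Theory.
Import numFieldNormedType.Exports.

Local Open Scope classical_set_scope.
Local Open Scope ring_scope.

(* Sequences indexed by j >= 1 are represented by functions on nat that are
   shifted by one: the value at j : nat is the term of index j.+1. *)

(* [cube] is {0,1}^N with the product sigma-algebra. *)
Definition cylinders : set (set (nat -> bool)) :=
  \bigcup_j preimage_set_system setT (fun x : nat -> bool => x j) measurable.

Notation cube := (g_sigma_algebraType cylinders).

Definition coordinate (j : nat) (x : cube) : bool := x j.

Lemma measurable_coordinate (j : nat) :
  measurable_fun [set: cube] (coordinate j).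
Proof.
move=> _ B mB; apply: sub_sigma_algebra.
by exists j => //; exists B.
Qed.

HB.instance Definition _ (j : nat) :=
  isMeasurableFun.Build _ _ cube bool (coordinate j) (measurable_coordinate j).

Definition mutually_independent (d d' : measure_display)
    (T : measurableType d) (T' : measurableType d') (R : realType)
    (P : probability T R) (I : eqType) (X : I -> {RV P >-> T'}) : Prop :=
  forall (s : seq I) (A : I -> set T'), uniq s ->
    (forall i, i \in s -> measurable (A i)) ->
    P (\bigcap_(i in [set` s]) (X i @^-1` A i)) =
    (\prod_(i <- s) P (X i @^-1` A i))%E.

Definition product_bernoulli (R : realType) (p : nat -> R)
    (mu : probability cube R) : Prop :=
  mutually_independent (P := mu) (fun j => coordinate j : {RV mu >-> bool}) /\
  forall (j : nat) (A : set bool),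
    distribution mu (coordinate j) A = bernoulli_prob (p j) A.

Definition iid_sample (d d' : measure_display)
    (T : measurableType d) (T' : measurableType d') (R : realType)
    (P : probability T R) (n : nat) (X : 'I_n -> {RV P >-> T'})
    (mu : probability T' R) : Prop :=
  mutually_independent X /\
  forall (i : 'I_n) (A : set T'), measurable A -> distribution P (X i) A = mu A.

Definition empirical_mean (d : measure_display) (T : measurableType d)
    (R : realType) (P : probability T R) (n : nat) (X : 'I_n -> {RV P >-> cube})
    (j : nat) (w : T) : R :=
  (\sum_(i < n) (coordinate j (X i w))%:R) / n%:R.

(* For p with values in [0, 1] the real supremum is that of a bounded set. *)
Definition expected_max_deviation (d : measure_display) (T : measurableType d)
    (R : realType) (P : probability T R) (n : nat) (X : 'I_n -> {RV P >-> cube})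
    (p : nat -> R) : \bar R :=
  'E_P[fun w => sup (range (fun j => `|empirical_mean X j w - p j|))].

(* Here [J] is the actual index, at least 1. *)
Definition phi (R : realType) (J : nat) (q : R) (n : nat) : R :=
  let L := ln J.+1%:R in
  if q == 0 then 0
  else if n%:R <= L / ln q^-1 then 1
  else if n%:R <= L / (expR 1 * q) then L / (n%:R * ln (L / (n%:R * q)))
  else Num.sqrt (q * L / n%:R).

(* The test on [q] is needed because [_ / 0 = 0] would turn the second term
   into ln (J + 1) / (n * ln 2) instead of 0. *)
Definition explicit_rate (R : realType) (J : nat) (q : R) (n : nat) : R :=
  let L := ln J.+1%:R in
  Num.max (Num.sqrt (q * L / n%:R))
    (if q == 0 then 0 else L / (n%:R * ln (2 + L / (n%:R * q)))).

Definition asymp (R : realType) (c C : R) (A B : \bar R) : Prop :=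
  (c%:E * B <= A)%E /\ (A <= C%:E * B)%E.

(* Main.v *)
(* Write L = ln (j + 1), with j >= 1 the actual index, and r_j for the j-th
   explicit rate.

   Upper bound: let s >= 16 r_j for all j. The maximal deviation is at most
     s + sum_j (exp (l_j (D_j - s)) + exp (l_j (- D_j - s))) / l_j,
   D_j being the deviation of coordinate j, and Chernoff's method provides
   l_j >= 1 / s for which the j-th term has expectation at most 2 s / (j + 1)^2.
   The expected maximum is then O(s), with no assumption on the sequence p.

   Lower bound: if p(j) >= 1 / (2nj), each of the first j coordinates, whose
   parameters are at least p(j), deviates by a constant times min (1, r_j) with
   probability at least b / j, so by independence the maximum does so with
   probability at least 1 - exp (- b). For L <= 256 n p this
   anti-concentration comes from a change of the parameter p to
   p - sqrt (p L / n) / 16, and for L > 256 n p from the single value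
   k = min (n, 1 + floor (L / (4 ln (L / (n p))))) of the binomial variable.

   An index with p(j) <= 1 / (2nj) has r_j <= 1 / n, while p(j) >= 1 / (2nj)
   forces r_j >= 1 / (3n); this separates the two regimes of the theorem. *)

Require Import Defs.
From HB Require Import structures.
From mathcomp Require Import all_boot all_order all_algebra.
From mathcomp Require Import ring lra zify.
From mathcomp Require Import all_classical all_reals all_analysis.
From mathcomp Require Import measurable_realfun.

Set Implicit Arguments.
Unset Strict Implicit.
Unset Printing Implicit Defensive.

Import Order.TTheory GRing.Theory Num.Theory.
Import numFieldNormedType.Exports.
Local Open Scope classical_set_scope.
Local Open Scope ring_scope.

(** * Elementary inequalities *)

Lemma ln_le_subr1 (R : realType) (x : R) : 0 < x -> ln x <= x - 1.
Proof.
move=> x0; have := @le_ln1Dx R (x - 1).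
have -> : 1 + (x - 1) = x by ring.
by apply; lra.
Qed.

Lemma ln_ge_1subV (R : realType) (x : R) : 0 < x -> 1 - x^-1 <= ln x.
Proof.
move=> x0; have := @ln_le_subr1 R x^-1; rewrite invr_gt0 => /(_ x0).
by rewrite lnV ?posrE//; lra.
Qed.

Lemma ln_sqrt (R : realType) (x : R) : 0 < x -> ln (Num.sqrt x) = ln x / 2.
Proof.
move=> x0; have s0 : 0 < Num.sqrt x by rewrite sqrtr_gt0.
by rewrite -[in RHS](sqr_sqrtr (ltW x0)) lnXn// mulr2n; lra.
Qed.

Lemma ln_le_sqrt (R : realType) (x : R) : 0 < x -> ln x <= 2 * Num.sqrt x.
Proof.
move=> x0; have s0 : 0 < Num.sqrt x by rewrite sqrtr_gt0.
have := ln_le_subr1 s0; rewrite ln_sqrt//; lra.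
Qed.

Lemma ln_natSS_ge (R : realType) (j : nat) : 2^-1 <= ln (j.+2%:R : R).
Proof.
apply: le_trans (@ln_ge_1subV R _ _); last by rewrite ltr0n.
have : (j.+2%:R^-1 : R) <= 2^-1 by rewrite lef_pV2 ?posrE ?ltr0n// ler_nat.
by move: (j.+2%:R^-1) => v; lra.
Qed.

Lemma ln_natSS_le (R : realType) (j : nat) : ln (j.+2%:R : R) <= j.+1%:R.
Proof.
apply: (le_trans (@ln_le_subr1 R _ _)); first by rewrite ltr0n.
by rewrite -natr1 addrK.
Qed.

(** With [x = u / p] and [y = s / p] this is the condition that [chernoff_tilt] needs once [p] is
    scaled out. For [x >= 1], [y >= 16 sqrt x] gives [2 + x <= (1 + y)^2], so the second hypothesis
    applies with [ln (1 + y)]. For [x < 1] the first one suffices, by [ln (1 + y) >= y / (1 + y) >=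
    16 sqrt x / 17]. *)
Lemma mul_ln_sqrt_ge (R : realType) (x y : R) : 0 < x ->
    16 * Num.sqrt x <= y -> 16 * (x / ln (2 + x)) <= y ->
  4 * x <= y * ln (Num.sqrt (1 + y)).
Proof.
move=> x0 h1 h2.
have sx0 : 0 < Num.sqrt x by rewrite sqrtr_gt0.
have xE := sqr_sqrtr (ltW x0).
have y0 : 0 < y by lra.
have l0 : 0 < ln (2 + x) by apply: ln_gt0; lra.
rewrite ln_sqrt; last lra.
have [x1|x1] := leP 1 x.
  have sx1 : 1 <= Num.sqrt x by rewrite -sqrtr1 ler_sqrt//; lra.
  have hl : ln (2 + x) <= 2 * ln (1 + y).
    rewrite mulr_natl -lnXn; last lra.
    rewrite ler_ln ?posrE; [nra|lra|apply: exprn_gt0; lra].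
  have h3 : 16 * x <= y * ln (2 + x).
    by move: h2; rewrite mulrA ler_pdivrMr.
  have : y * ln (2 + x) <= y * (2 * ln (1 + y)) by rewrite ler_pM2l.
  lra.
set r := Num.sqrt x in sx0 xE h1 *.
have r1 : r < 1 by rewrite /r -sqrtr1 ltr_sqrt//.
have h3 : y / (1 + y) <= ln (1 + y).
  have -> : y / (1 + y) = 1 - (1 + y)^-1 by field; lra.
  by apply: ln_ge_1subV; lra.
have h4 : (16 * r) / (1 + 16 * r) <= y / (1 + y).
  rewrite ler_pdivrMr; last lra.
  rewrite mulrAC ler_pdivlMr; last lra.
  nra.
have h5 : 16 * r / 17 <= (16 * r) / (1 + 16 * r).
  rewrite ler_pM2l; last lra.
  by rewrite lef_pV2 ?posrE; lra.
have h6 : 16 * r / 17 <= ln (1 + y) by lra.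
have : (16 * r) * (16 * r / 17) <= y * ln (1 + y).
  by apply: ler_pM => //; lra.
nra.
Qed.

(* The tilt is [ln (1 + s / p) / 2] rather than Cramer's optimal
   [ln (1 + s / p)]: the exponents are then bounded by elementary algebra. *)
Lemma chernoff_tilt (R : realType) (p s u : R) : 0 <= p -> 0 < s -> 0 < u ->
    16 * Num.sqrt (p * u) <= s ->
    (p != 0 -> 16 * (u / ln (2 + u / p)) <= s) ->
  exists m : R, [/\ 0 < m, 4 * u <= m * s,
    p * (expR m - 1 - m) - m * s <= - 2 * u &
    p * (expR (- m) - 1 + m) - m * s <= - 2 * u].
Proof.
move=> p0 s0 u0 h1 h2; have [pE|pN] := eqVneq p 0.
  exists (4 * u / s); rewrite pE !mul0r divfK ?gt_eqF//.
  by split; [apply: divr_gt0; lra|lra|lra|lra].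
have {p0 pN}[p0 {}h2] : 0 < p /\ 16 * (u / ln (2 + u / p)) <= s.
  by rewrite lt0r pN p0; split=> //; apply: h2.
pose x := u / p; pose y := s / p; pose z := Num.sqrt (1 + y).
have uE : u = p * x by rewrite /x; field; lra.
have sE : s = p * y by rewrite /y; field; lra.
have x0 : 0 < x by apply: divr_gt0.
have y0 : 0 < y by apply: divr_gt0.
have k1 : 16 * Num.sqrt x <= y.
  have sq : Num.sqrt (p * u) = p * Num.sqrt x.
    by rewrite uE mulrA -expr2 sqrtrM ?sqr_ge0// sqrtr_sqr gtr0_norm.
  by rewrite -(ler_pM2l p0) -sE; apply: le_trans h1; rewrite sq; lra.
have k2 : 16 * (x / ln (2 + x)) <= y.
  rewrite -(ler_pM2l p0) -sE; apply: le_trans h2.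
  rewrite -/x uE; lra.
have kk := mul_ln_sqrt_ge x0 k1 k2; rewrite -/z in kk.
have z2 : z ^+ 2 = 1 + y by rewrite sqr_sqrtr//; lra.
have z1 : 1 < z by rewrite -[1]sqrtr1 ltr_sqrt; lra.
have z0 : 0 < z by lra.
have lu := ln_le_subr1 z0; have ll := ln_ge_1subV z0.
have l0 : 0 < ln z by apply: ln_gt0.
have zV : z * z^-1 = 1 by rewrite mulfV//; lra.
have zV0 : 0 < z^-1 by rewrite invr_gt0.
have zV1 : z^-1 < 1 by rewrite invf_lt1.
exists (ln z); rewrite expRN lnK ?posrE//; split => //.
- rewrite uE sE; nra.
(* By [kk], half of [y * ln z] pays for [2 * x]; the other half must absorb the exponential
   remainder. With [y = z^2 - 1] this follows from [z - 1 <= z * ln z] and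
   [0 <= (z - 1)^2 * ln z]. *)
- suff : z - 1 - ln z <= y * ln z / 2 by rewrite uE sE; nra.
  have yE : y = z ^+ 2 - 1 by lra.
  have : z - 1 <= ln z * z by nra.
  have : 0 <= ln z * (z - 1) ^+ 2 by apply: mulr_ge0; [lra|exact: sqr_ge0].
  rewrite yE; nra.
- suff : z^-1 - 1 + ln z <= y * ln z / 2 by rewrite uE sE; nra.
  have yE : y = z ^+ 2 - 1 by lra.
  have e1 : z^-1 * ln z <= z^-1 * (z - 1) by rewrite ler_pM2l.
  have e2 : z^-1 - 1 + ln z <= ln z * (1 - z^-1) by nra.
  have e3 : 1 - z^-1 <= y / 2 by rewrite yE; nra.
  have : ln z * (1 - z^-1) <= ln z * (y / 2) by rewrite ler_pM2l.
  lra.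
Qed.

Lemma expR_le_quadratic (R : realType) (m : R) : 0 <= m <= 2^-1 ->
  expR m <= 1 + m + 2 * m ^+ 2.
Proof.
move=> /andP[m0 m1]; have h := @expR_ge1Dx R (- m).
have e0 := expR_gt0 m.
have h1 : expR m * (1 - m) <= 1.
  apply: le_trans (_ : expR m * expR (- m) <= 1);
    by rewrite ?ler_pM2l ?expRxMexpNx_1.
(* The product equals [1 + m^2 * (1 - 2 m)]. *)
have h2 : 1 <= (1 + m + 2 * m ^+ 2) * (1 - m) by nra.
by rewrite -(@ler_pM2r _ (1 - m)) ?(le_trans h1)//; lra.
Qed.

Lemma onem_ge_expR (R : realType) (p : R) : 0 <= p <= 2^-1 ->
  expR (- (2 * p)) <= 1 - p.
Proof.
move=> /andP[p0 p1]; rewrite -[leRHS]lnK ?posrE; last lra.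
rewrite ler_expR; apply: le_trans (ln_ge_1subV _); last lra.
have v0 : 0 < (1 - p)^-1 by rewrite invr_gt0; lra.
have vE : (1 - p) * (1 - p)^-1 = 1 by rewrite mulfV//; lra.
nra.
Qed.

(** * Binomial probabilities *)

(** The absorption identity [(k + 1) C(n + 1, k + 1) = (n + 1) C(n, k)] reduces the induction step
    to [(n + 1)^k <= C(n, k) (k + 1)^k], which follows from the hypothesis for [k] because
    [(n + 1) / n <= (k + 1) / k]. *)
Lemma expn_le_bin (n k : nat) : (k <= n)%N -> (n ^ k <= 'C(n, k) * k ^ k)%N.
Proof.
elim: k n => [|k IH] [|n]//; rewrite ltnS => kn.
have {}IH := IH n kn.
suff h : (n.+1 ^ k <= 'C(n, k) * k.+1 ^ k)%N.
  rewrite expnS (expnS k.+1) mulnCA mulnA -mul_bin_diag /= -mulnA.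
  by rewrite leq_mul2l h orbT.
case: k kn IH => [|k] kn IH; first by rewrite !expn0 bin0.
have k0 : (0 < k.+1 ^ k.+1)%N by rewrite expn_gt0.
rewrite -(leq_pmul2r k0) mulnAC.
apply: (@leq_trans (n ^ k.+1 * k.+2 ^ k.+1)); last by rewrite leq_mul2r IH orbT.
rewrite -!expnMn leq_exp2r//; lia.
Qed.

Lemma binomial_pmf_ge0 (R : realType) (n k : nat) (p : R) : 0 <= p <= 1 ->
  0 <= binomial_pmf n p k.
Proof.
move=> /andP[p0 p1]; apply: mulrn_wge0; apply: mulr_ge0; apply: exprn_ge0 => //.
by rewrite /unstable.onem subr_ge0.
Qed.

Lemma sum_binomial_pmf_exp (R : realType) (n : nat) (p x : R) :
  \sum_(k < n.+1) binomial_pmf n p k * x ^+ k = (1 - p + p * x) ^+ n.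
Proof.
rewrite exprDn; apply: eq_bigr => k _.
by rewrite /binomial_pmf /unstable.onem mulrnAl exprMn mulrAC mulrC mulrA.
Qed.

Lemma sum_binomial_pmf (R : realType) (n : nat) (p : R) :
  \sum_(k < n.+1) binomial_pmf n p k = 1.
Proof.
have := sum_binomial_pmf_exp n p 1; rewrite mulr1 subrK expr1n => <-.
by apply: eq_bigr => k _; rewrite expr1n mulr1.
Qed.

(** The bound is the Laplace transform of the Poisson law with the same mean. *)
Lemma sum_binomial_pmf_expR (R : realType) (n : nat) (p t : R) : 0 <= p <= 1 ->
  \sum_(k < n.+1) binomial_pmf n p k * expR (t * k%:R) <=
  expR (n%:R * p * (expR t - 1)).
Proof.
move=> /andP[p0 p1].
under eq_bigr do rewrite (mulrC t) expRM_natl.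
rewrite sum_binomial_pmf_exp -mulrA expRM_natl.
have t0 := expR_gt0 t.
apply: lerXn2r; rewrite ?nnegrE ?expR_ge0//; first nra.
apply: le_trans (@expR_ge1Dx R _); lra.
Qed.

Lemma binomial_upper_tail (R : realType) (n : nat) (p t a : R) : 0 <= p <= 1 ->
    0 <= t ->
  \sum_(k < n.+1 | n%:R * p + a <= k%:R) binomial_pmf n p k <=
  expR (n%:R * p * (expR t - 1 - t) - t * a).
Proof.
move=> p01 t0.
apply: (@le_trans _ _ (expR (- (t * (n%:R * p + a))) *
   \sum_(k < n.+1) binomial_pmf n p k * expR (t * k%:R))).
  rewrite mulr_sumr big_mkcond/=; apply: ler_sum => k _.
  have pk := @binomial_pmf_ge0 R n k p p01.
  case: ifPn => [h|_]; last by rewrite !mulr_ge0// expR_ge0.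
  rewrite mulrCA -expRD ler_peMr// -[leLHS]expR0 ler_expR.
  by rewrite addrC subr_ge0 ler_wpM2l.
apply: le_trans (_ : expR (- (t * (n%:R * p + a))) *
   expR (n%:R * p * (expR t - 1)) <= _).
  by rewrite ler_pM2l ?expR_gt0// sum_binomial_pmf_expR.
by rewrite -expRD ler_expR; lra.
Qed.

(* The exponential bounds one plus the chi-square divergence of the two laws;
   the Cauchy-Schwarz inequality is replaced by AM-GM, term by term. *)
Lemma binomial_change_of_measure (R : realType) (n : nat) (p q : R)
    (A : pred nat) : 0 < p <= 2^-1 -> 0 <= q <= 1 ->
  (\sum_(k < n.+1 | A k) binomial_pmf n q k) ^+ 2 <=
  expR (2 * n%:R * (p - q) ^+ 2 / p) * \sum_(k < n.+1 | A k) binomial_pmf n p k.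
Proof.
move=> /andP[p0 p1] /andP[q0 q1].
set Q := \sum_(k < n.+1 | A k) binomial_pmf n q k.
set P := \sum_(k < n.+1 | A k) binomial_pmf n p k.
set M := expR _.
(* This is the squared mass under [q] over the mass under [p], written so that the binomial theorem
   sums it. *)
pose D k := (q ^+ 2 / p) ^+ k * ((1 - q) ^+ 2 / (1 - p)) ^+ (n - k) *+ 'C(n, k).
have M0 : 0 < M by exact: expR_gt0.
have Q0 : 0 <= Q by apply: sumr_ge0 => k _; apply: binomial_pmf_ge0; apply/andP.
have D0 k : 0 <= D k.
  apply: mulrn_wge0; apply: mulr_ge0; apply: exprn_ge0; apply: divr_ge0;
    rewrite ?sqr_ge0//; lra.
have DM : \sum_(k < n.+1) D k <= M.
  have -> : \sum_(k < n.+1) D k = ((1 - q) ^+ 2 / (1 - p) + q ^+ 2 / p) ^+ n.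
    by rewrite exprDn; apply: eq_bigr => k _; rewrite /D mulrC.
  have -> : M = expR (2 * (p - q) ^+ 2 / p) ^+ n.
    rewrite /M -expRM_natl; congr expR; ring.
  apply: lerXn2r; rewrite ?nnegrE ?expR_ge0//.
    apply: addr_ge0; apply: divr_ge0; rewrite ?sqr_ge0//; lra.
  apply: le_trans (@expR_ge1Dx R _).
  (* One trial contributes [1 + (p - q)^2 / (p (1 - p))]; the factor 2 in [M] comes from
     [1 - p >= 1/2]. *)
  have -> : (1 - q) ^+ 2 / (1 - p) + q ^+ 2 / p =
      1 + (p - q) ^+ 2 / p * (1 - p)^-1 by field; lra.
  have -> : 2 * (p - q) ^+ 2 / p = (p - q) ^+ 2 / p * 2 by ring.
  rewrite lerD2l ler_wpM2l//.
    by apply: divr_ge0; rewrite ?sqr_ge0//; lra.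
  by rewrite -[leRHS]invrK lef_pV2 ?posrE; lra.
have Dk k : (binomial_pmf n q k) ^+ 2 = D k * binomial_pmf n p k.
  rewrite /D /binomial_pmf /unstable.onem !expr_div_n -!exprM !(mulnC 2) !exprM.
  rewrite -(mulr_natr (q ^+ k * _)) -(mulr_natr (p ^+ k * _)).
  rewrite -(mulr_natr (_ / _ * _)).
  have c0 : p ^+ k != 0 by rewrite expf_neq0//; lra.
  have d0 : (1 - p) ^+ (n - k) != 0 by rewrite expf_neq0//; lra.
  move: (q ^+ k) ((1 - q) ^+ _) (p ^+ _) ((1 - p) ^+ _) c0 d0 => a b c d c0 d0.
  by field; apply/andP.
have [->|QN] := eqVneq Q 0.
  rewrite expr0n /= mulr_ge0 ?expR_ge0//.
  by apply: sumr_ge0 => k _; apply: binomial_pmf_ge0; lra.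
have {QN}Q0 : 0 < Q by rewrite lt0r QN.
(* This weight optimises the bound [2 e Q <= e^2 M + P], which then reads [Q^2 <= M P]. *)
pose e := Q / M; have e0 : 0 < e by apply: divr_gt0.
have key : Q * (2 * e) <= e ^+ 2 * M + P.
  rewrite mulr_suml.
  apply: (@le_trans _ _ (\sum_(k < n.+1 | A k)
       (e ^+ 2 * D k + binomial_pmf n p k))).
    apply: ler_sum => k _; have := Dk k; have := D0 k.
    have : 0 <= binomial_pmf n p k by apply: binomial_pmf_ge0; lra.
    move: (binomial_pmf n p k) (binomial_pmf n q k) (D k) => x y z x0 z0 yE.
    have h : (2 * (e * y)) ^+ 2 <= (e ^+ 2 * z + x) ^+ 2.
      have := sqr_ge0 (e ^+ 2 * z - x).
      rewrite !exprMn yE; nra.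
    have h0 : 0 <= e ^+ 2 * z + x by rewrite addr_ge0// mulr_ge0// sqr_ge0.
    have [y0|y0] := leP 0 y; last by apply: le_trans h0; nra.
    have h1 : 0 <= 2 * (e * y).
      by apply: mulr_ge0 => //; apply: mulr_ge0 => //; lra.
    by move: h; rewrite ler_sqr ?nnegrE//; lra.
  rewrite big_split/= lerD2r -mulr_sumr ler_wpM2l ?sqr_ge0//.
  apply: le_trans DM; rewrite big_mkcond/=; apply: ler_sum => k _.
  by case: ifP.
have eM : e * M = Q by rewrite /e divfK ?gt_eqF.
have : Q ^+ 2 = M * (Q * e) by rewrite -eM; ring.
have : M * (Q * (2 * e)) <= M * (e ^+ 2 * M + P) by rewrite ler_pM2l.
have -> : M * (e ^+ 2 * M + P) = M * (Q * e) + M * P by rewrite -eM; ring.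
lra.
Qed.

Lemma binomial_pmf_ge (R : realType) (n k : nat) (p : R) : 0 <= p <= 2^-1 ->
    (0 < k <= n)%N ->
  (n%:R * p / k%:R) ^+ k * expR (- (2 * (n%:R * p))) <= binomial_pmf n p k.
Proof.
move=> /andP[p0 p1] /andP[k0 kn].
have kR : 0 < k%:R :> R by rewrite ltr0n.
have h1 : expR (- (2 * (n%:R * p))) <= (1 - p) ^+ (n - k).
  apply: (@le_trans _ _ ((1 - p) ^+ n)).
    have -> : - (2 * (n%:R * p)) = n%:R * (- (2 * p)) by ring.
    rewrite expRM_natl; apply: lerXn2r; rewrite ?nnegrE ?expR_ge0//;
      first lra.
    by apply: onem_ge_expR; apply/andP.
  by apply: ler_wiXn2l; [lra|lra|exact: leq_subr].
have h2 : (n%:R * p / k%:R) ^+ k <= p ^+ k *+ 'C(n, k).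
  rewrite -[leRHS]mulr_natl mulrAC exprMn ler_wpM2r ?exprn_ge0//.
  rewrite expr_div_n ler_pdivrMr ?exprn_gt0//.
  by rewrite -!natrX -natrM ler_nat expn_le_bin.
rewrite /binomial_pmf -mulrnAl; apply: ler_pM; rewrite ?expR_ge0//.
by rewrite exprn_ge0// divr_ge0// ?mulr_ge0.
Qed.

(** Grouping the sets of successful trials by cardinality passes from the law of the set to the law
    of its size. *)
Lemma sum_set_binomial_pmf (R : realType) (n : nat) (q : R) (B : pred nat) :
  \sum_(A : {set 'I_n} | B #|A|) \prod_i (if i \in A then q else 1 - q) =
  \sum_(k < n.+1 | B k) binomial_pmf n q k.
Proof.
have cn (A : {set 'I_n}) : (#|A| < n.+1)%N.
  by rewrite ltnS -[leqRHS]card_ord max_card.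
rewrite (partition_big (fun A : {set 'I_n} => Ordinal (cn A)) (fun k => B k))//=.
apply: eq_bigr => k Bk.
rewrite (eq_bigr (fun=> q ^+ k * (1 - q) ^+ (n - k))); last first.
  move=> A /andP[_ /eqP/(congr1 val)/= Ak].
  rewrite big_if/= !prodr_const Ak; congr (_ * _ ^+ _).
  have <- : #|~: A| = (n - k)%N by rewrite cardsCs finset.setCK Ak card_ord.
  by apply: eq_card => i; rewrite !inE.
rewrite sumr_const /binomial_pmf /unstable.onem; congr (_ *+ _).
rewrite -[n in 'C(n, _)]card_ord -card_draws; apply: eq_card => A.
rewrite unfold_in inE/=.
apply/andP/idP => [[_ /eqP/(congr1 val)/= ->]//|/eqP Ak].
by split; [rewrite Ak|apply/eqP/val_inj].
Qed.

(** * Anti-concentration of the binomial distribution *)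

Lemma natSS_le (R : realType) (j : nat) : (j.+2%:R : R) <= 2 * j.+1%:R.
Proof. by rewrite -natrM ler_nat; lia. Qed.

Lemma natSS_inv_ge (R : realType) (j : nat) :
  (2 * j.+1%:R)^-1 <= (j.+2%:R : R)^-1.
Proof. by rewrite lef_pV2 ?posrE ?pmulr_rgt0 ?ltr0n// natSS_le. Qed.

(** Under the parameter [q = p - d / 16], the frequency is below [q + d / 32 = p - d / 32] with
    constant probability. Returning to [p] costs a factor [exp (L / 128)], at most [j + 2]. *)
Lemma gaussian_anticoncentration (R : realType) (n j : nat) (p : R) :
    (0 < n)%N -> 0 < p <= 2^-1 ->
    ln j.+2%:R <= 16 ^+ 2 * (n%:R * p) ->
  (1 - expR (- ((8 * 16)^-1 ^+ 2))) ^+ 2 / (2 * j.+1%:R) <=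
  \sum_(k < n.+1 | (32 * 32)^-1 * explicit_rate j.+1 p n <= `|k%:R / n%:R - p|)
    binomial_pmf n p k.
Proof.
move=> n0 /andP[p0 p1]; rewrite /explicit_rate.
have := @ln_natSS_ge R j; have : expR (ln j.+2%:R) = j.+2%:R :> R.
  by rewrite lnK// posrE ltr0n.
set L := ln _ => LE L1 Lp; clearbody L.
have nR : 0 < n%:R :> R by rewrite ltr0n.
set d := Num.sqrt (p * L / n%:R).
have d0 : 0 < d.
  by rewrite sqrtr_gt0; apply: divr_gt0 => //; apply: mulr_gt0 => //; lra.
have dE : n%:R * d ^+ 2 = p * L.
  rewrite sqr_sqrtr; first by field; lra.
  by apply: divr_ge0; [apply: mulr_ge0; lra|lra].
clearbody d.
(* This makes [q] below nonnegative; it is where [L <= 256 n p] enters. *)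
have dp : d <= 16 * p.
  rewrite -ler_sqr ?nnegrE; [|lra|lra].
  by rewrite -(ler_pM2l nR) dE; nra.
(* The logarithm is at least 1/2 and [L <= 16 n d], so the second term of the rate is at most
   [32 d]. *)
have rate_le : (32 * 32)^-1 * Num.max d (if p == 0 then 0 else
    L / (n%:R * ln (2 + L / (n%:R * p)))) <= d / 32.
  suff : Num.max d (if p == 0 then 0 else
    L / (n%:R * ln (2 + L / (n%:R * p)))) <= 32 * d by lra.
  rewrite gt_eqF// ge_max; apply/andP; split; first lra.
  have l2 : 2^-1 <= ln (2 + L / (n%:R * p)).
    have x0 : 0 <= L / (n%:R * p) by apply: divr_ge0; [lra|apply: mulr_ge0; lra].
    apply: le_trans (@ln_natSS_ge R 0) _.
    by rewrite ler_ln ?posrE ?ltr0n//; lra.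
  move: (ln (2 + _)) l2 => l l2.
  have lp : 0 < n%:R * l by apply: mulr_gt0; lra.
  rewrite ler_pdivrMr//.
  have : 2^-1 * (n%:R * d) <= l * (n%:R * d).
    by apply: ler_wpM2r => //; apply: mulr_ge0; lra.
  have : p * L <= p * (16 * (n%:R * d)).
    have : n%:R * d * d <= n%:R * d * (16 * p).
      by apply: ler_wpM2l => //; apply: mulr_ge0; lra.
    lra.
  rewrite ler_pM2l//; lra.
pose q := p - d / 16.
pose tail := \sum_(k < n.+1 | n%:R * q + n%:R * d / 32 <= k%:R)
  binomial_pmf n q k.
have q01 : 0 <= q <= 1 by apply/andP; rewrite /q; split; lra.
have tailE : tail <= expR (- ((8 * 16)^-1 ^+ 2)).
  (* With this tilt the quadratic term [2 n p m^2] is half of the linear term [m n d / 32]. The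
     remaining exponent is [- L / (64 * 128)], and [L >= 1/2]. *)
  pose m := d / ((8 * 16) * p).
  have m0 : 0 <= m by apply: divr_ge0; lra.
  have mp : m * p = d / (8 * 16) by rewrite /m; field; lra.
  have m1 : m <= 2^-1 by rewrite /m ler_pdivrMr; lra.
  apply: le_trans (binomial_upper_tail _ _ q01 m0) _; rewrite ler_expR.
  have mm : 0 <= m <= 2^-1 by apply/andP.
  have e1 := expR_le_quadratic mm.
  have e2 : expR m - 1 - m <= 2 * m ^+ 2 by lra.
  have e3 : 0 <= expR m - 1 - m by have := @expR_ge1Dx R m; lra.
  have : q * (expR m - 1 - m) <= p * (2 * m ^+ 2).
    by apply: ler_pM => //; rewrite /q; lra.
  rewrite -(ler_pM2l nR) mulrA.
  have -> : n%:R * (p * (2 * m ^+ 2)) = n%:R * d * m / 64.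
    have -> : n%:R * (p * (2 * m ^+ 2)) = 2 * n%:R * m * (m * p) by ring.
    by rewrite mp; field.
  have : L / (64 * (8 * 16)) <= n%:R * d * m / 64.
    have -> : L / (64 * (8 * 16)) = n%:R * d ^+ 2 / p / (64 * (8 * 16)).
      by rewrite dE; field; lra.
    have -> : n%:R * d ^+ 2 / p / (64 * (8 * 16)) = n%:R * d * m / 64.
      by rewrite /m; field; lra.
    by [].
  lra.
have sum1 := sum_binomial_pmf n q.
rewrite (bigID (fun k : 'I_n.+1 => n%:R * q + n%:R * d / 32 <= k%:R))/= in sum1.
rewrite -/tail in sum1.
pose Q := \sum_(k < n.+1 | ~~ (n%:R * q + n%:R * d / 32 <= k%:R))
  binomial_pmf n q k.
rewrite -/Q in sum1.
have p012 : 0 < p <= 2^-1 by apply/andP.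
have := @binomial_change_of_measure R n p q
  (fun k => ~~ (n%:R * q + n%:R * d / 32 <= k%:R)) p012 q01.
rewrite -/Q.
have e1 : expR (- ((8 * 16)^-1 ^+ 2)) < 1 :> R.
  by rewrite -[ltRHS]expR0 ltr_expR; lra.
have h1 : (1 - expR (- ((8 * 16)^-1 ^+ 2))) ^+ 2 <= Q ^+ 2.
  by rewrite lerXn2r ?nnegrE//; lra.
move=> /(le_trans h1) {}h1.
set P := (X in _ <= _ * X) in h1.
have PP : P <= \sum_(k < n.+1 | (32 * 32)^-1 * Num.max d (if p == 0 then 0 else
    L / (n%:R * ln (2 + L / (n%:R * p)))) <= `|k%:R / n%:R - p|)
    binomial_pmf n p k.
  rewrite /P big_mkcond [leRHS]big_mkcond/=; apply: ler_sum => k _.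
  have pk : 0 <= binomial_pmf n p k.
    by apply: binomial_pmf_ge0; apply/andP; split; lra.
  case: ifPn => [|_]; last by case: ifP.
  rewrite -ltNge => hk; rewrite ifT//.
  apply: le_trans rate_le _.
  rewrite ler_normr; apply/orP; right.
  have : k%:R / n%:R <= q + d / 32.
    by rewrite ler_pdivrMr//; move: hk; rewrite /q; lra.
  rewrite /q; lra.
apply: le_trans PP.
have M1 : expR (2 * n%:R * (p - q) ^+ 2 / p) <= j.+2%:R.
  rewrite -LE ler_expR /q.
  have -> : 2 * n%:R * (p - (p - d / 16)) ^+ 2 / p = (n%:R * d ^+ 2) / p / (8 * 16).
    by field; lra.
  have -> : n%:R * d ^+ 2 / p / (8 * 16) = L / (8 * 16) by rewrite dE; field; lra.
  lra.
have P0 : 0 <= P.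
  apply: sumr_ge0 => k _; apply: binomial_pmf_ge0; apply/andP; split; lra.
have j0 : 0 < 2 * j.+1%:R :> R by apply: mulr_gt0; rewrite ltr0n.
rewrite ler_pdivrMr//; apply: le_trans h1 _; rewrite mulrC ler_wpM2l//.
exact: le_trans M1 (natSS_le _ _).
Qed.

Lemma ln_le_eighth (R : realType) (x : R) : 16 ^+ 2 <= x -> 8 * ln x <= x.
Proof.
move=> x256; have x0 : 0 < x by lra.
have := ln_le_sqrt x0; have := sqr_sqrtr (ltW x0).
have : 16 <= Num.sqrt x.
  have -> : 16 = Num.sqrt (16 ^+ 2) :> R by rewrite sqrtr_sqr ger0_norm.
  by rewrite ler_sqrt; lra.
move: (Num.sqrt x) => s; nra.
Qed.

Lemma ln_256_ge4 (R : realType) : 4 <= ln (16 ^+ 2 : R).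
Proof.
have -> : 16 ^+ 2 = 2 ^+ 8 :> R by ring.
by rewrite lnXn// -mulr_natl; have := @ln_natSS_ge R 0; lra.
Qed.

(** If [k <= L / (2 ln x)], then [n p / k >= 1 / x], so the mass at [k] is at least
    [exp (- k ln x - 2 n p)], hence at least [exp (- L) = 1 / (j + 2)]. The value [k = 1] is
    separate because [L / (2 ln x)] may be below 1; its mass is at least [n p exp (- 2 n p)], and
    [n p >= 1 / (2 (j + 1))]. *)
Lemma binomial_pmf_poisson_ge (R : realType) (n j k : nat) (p x : R) :
    let L := ln j.+2%:R in
    0 < p <= 2^-1 -> (2 * n%:R * j.+1%:R)^-1 <= p -> (0 < k <= n)%N ->
    16 ^+ 2 <= x -> L = x * (n%:R * p) ->
    (k == 1)%N || (k%:R <= L / (2 * ln x)) ->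
  expR (- 2) / (2 * j.+1%:R) <= binomial_pmf n p k.
Proof.
move=> L /andP[p0 p1] pj /andP[k0 kn] x256 LE kle.
have p01 : 0 <= p <= 2^-1 by rewrite (ltW p0).
have kn' : (0 < k <= n)%N by rewrite k0.
apply: le_trans (binomial_pmf_ge p01 kn').
have n0 : 0 < n%:R :> R by rewrite ltr0n; apply: leq_trans kn.
have j0 : 0 < 2 * j.+1%:R :> R by rewrite pmulr_rgt0 ?ltr0n.
have eL : (2 * j.+1%:R)^-1 <= expR (- L).
  by rewrite expRN lnK ?natSS_inv_ge// posrE ltr0n.
clearbody L.
have e2 : expR (- 2) <= 1 :> R by rewrite -[leRHS]expR0 ler_expR; lra.
have e20 : 0 < expR (- 2) :> R by exact: expR_gt0.
have N0 : 0 < n%:R * p by apply: mulr_gt0.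
have NL : 16 ^+ 2 * (n%:R * p) <= L by rewrite LE ler_pM2r.
have jV : 0 < (2 * j.+1%:R : R)^-1 by rewrite invr_gt0.
have Nj : (2 * j.+1%:R)^-1 <= n%:R * p.
  move: pj; rewrite -(ler_pM2l n0) (mulrC 2) -mulrA invfM mulrA.
  by rewrite mulfV ?gt_eqF// mul1r.
move: kle => /orP[/eqP ->|kle].
  rewrite expr1 divr1; have [N1|N1] := leP (n%:R * p) 1.
    rewrite mulrC; apply: ler_pM; rewrite ?(ltW jV) ?expR_ge0// ler_expR; lra.
  apply: (@le_trans _ _ (1 * expR (- L))).
    rewrite mul1r; apply: le_trans eL.
    by rewrite ler_piMl// ltW.
  apply: ler_pM; rewrite ?expR_ge0 ?ler_expR//; lra.
apply: (@le_trans _ _ (expR (- L))).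
  by apply: le_trans eL; rewrite ler_piMl// ltW.
have lx : 4 <= ln x.
  by apply: le_trans (ln_256_ge4 R) _; rewrite ler_ln ?posrE; lra.
have kR : 0 < k%:R :> R by rewrite ltr0n.
have kx : k%:R <= n%:R * p * x.
  apply: (le_trans kle); rewrite ler_pdivrMr; last lra.
  by rewrite (mulrC _ x) -LE ler_peMr; lra.
have h : expR (- (k%:R * ln x)) <= (n%:R * p / k%:R) ^+ k.
  rewrite -mulrN expRM_natl; apply: lerXn2r; rewrite ?nnegrE ?expR_ge0//.
    by apply: divr_ge0; exact: ltW.
  rewrite expRN lnK ?posrE; last lra.
  by rewrite ler_pdivlMr// mulrC ler_pdivrMr; lra.
apply: le_trans (_ : expR (- (k%:R * ln x)) * expR (- (2 * (n%:R * p))) <= _).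
  rewrite -expRD ler_expR.
  move: kle; rewrite ler_pdivlMr; lra.
by rewrite ler_pM2r ?expR_gt0.
Qed.

Lemma poisson_anticoncentration (R : realType) (n j : nat) (p : R) :
    (0 < n)%N -> 0 < p <= 2^-1 -> (2 * n%:R * j.+1%:R)^-1 <= p ->
    16 ^+ 2 * (n%:R * p) <= ln j.+2%:R ->
  expR (- 2) / (2 * j.+1%:R) <=
  \sum_(k < n.+1 | 16^-1 * Num.min 1 (explicit_rate j.+1 p n) <=
      `|k%:R / n%:R - p|) binomial_pmf n p k.
Proof.
move=> n0 p012 pj; case/andP: (p012) => p0 p1; rewrite /explicit_rate gt_eqF//.
set L := ln _ => NL.
have nR : 0 < n%:R :> R by rewrite ltr0n.
have N0 : 0 < n%:R * p by exact: mulr_gt0.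
have L0 : 0 < L by lra.
pose x := L / (n%:R * p); rewrite -/x.
have x256 : 16 ^+ 2 <= x by rewrite ler_pdivlMr.
have LE : L = x * (n%:R * p) by rewrite divfK// gt_eqF.
have l4 : 4 <= ln x.
  by apply: le_trans (ln_256_ge4 R) _; rewrite ler_ln ?posrE; lra.
have lx := ln_le_eighth x256.
set l := ln x in l4 lx *.
(* The constant 4 leaves room for rounding up: if [r >= 1], then [floor r + 1 <= 2 r = L / (2 l)],
   the limit in [binomial_pmf_poisson_ge]. *)
pose r := L / (4 * l).
have r0 : 0 <= r by apply: divr_ge0; lra.
have rE : r * (4 * l) = L by rewrite divfK//; lra.
have rN : 2 * (n%:R * p) <= r.
  rewrite ler_pdivlMr; last lra.
  rewrite LE; nra.
(* The square root equals [p sqrt x], and [ln x <= 2 sqrt x] bounds it by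
   [2 p x / ln x = 8 r / n]. *)
have rate_le : Num.max (Num.sqrt (p * L / n%:R)) (L / (n%:R * ln (2 + x))) <=
    8 * (r / n%:R).
  rewrite ge_max; apply/andP; split.
    have sx0 : 0 < Num.sqrt x by rewrite sqrtr_gt0; lra.
    have -> : p * L / n%:R = (p * Num.sqrt x) ^+ 2.
      by rewrite exprMn sqr_sqrtr; [rewrite LE; field; lra|lra].
    rewrite sqrtr_sqr ger0_norm; last by apply: mulr_ge0; lra.
    have -> : 8 * (r / n%:R) = 2 * (p * x) / l.
      by rewrite /r LE; field; lra.
    rewrite ler_pdivlMr; last lra.
    have xE : x = Num.sqrt x ^+ 2 by rewrite sqr_sqrtr//; lra.
    rewrite [in leRHS]xE.
    have h : l <= 2 * Num.sqrt x by apply: ln_le_sqrt; lra.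
    have : (p * Num.sqrt x) * l <= (p * Num.sqrt x) * (2 * Num.sqrt x).
      by apply: ler_wpM2l => //; apply: mulr_ge0; lra.
    lra.
  have ll : l <= ln (2 + x) by rewrite ler_ln ?posrE; lra.
  have -> : 8 * (r / n%:R) = 2 * (L / (n%:R * l)) by rewrite /r; field; lra.
  apply: (@le_trans _ _ (L / (n%:R * l))).
    rewrite ler_pM2l// lef_pV2 ?posrE ?ler_pM2l//; apply: mulr_gt0 => //; lra.
  by rewrite ler_peMl; [|apply: divr_ge0; [lra|apply: mulr_ge0; lra]|lra].
pose k0 := (Num.truncn r).+1; pose k := minn n k0.
have k0n : (0 < k <= n)%N by rewrite leq_min n0 geq_minl.
have rk0 : r < k0%:R by apply: truncnS_gt.
have k0r : (k == 1)%N || (k%:R <= L / (2 * ln x)).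
  have -> : L / (2 * ln x) = 2 * r by rewrite -rE -/l; field; lra.
  case: (eqVneq k 1) => //= kN1.
  have k2 : (1 < k)%N by rewrite ltn_neqAle eq_sym kN1; case/andP: k0n.
  have kk : (k <= k0)%N by exact: geq_minr.
  have tr : (Num.truncn r)%:R <= r by rewrite truncn_le.
  have t1 : 1 <= (Num.truncn r)%:R :> R.
    by rewrite ler1n -ltnS; exact: leq_trans k2 kk.
  apply: (@le_trans _ _ k0%:R); first by rewrite ler_nat.
  by rewrite /k0 -natr1; lra.
apply: le_trans (binomial_pmf_poisson_ge p012 pj k0n x256 LE k0r) _.
have kn1 : (k < n.+1)%N by rewrite ltnS; case/andP: k0n.
(* The single value [k] belongs to the event. If [k = n], the deviation is [1 - p >= 1/2]; if
   [k = k0], it exceeds [r / n - p >= r / (2 n)], because [2 n p <= r]. *)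
rewrite (bigD1 (Ordinal kn1))/=; last first.
  set rate := Num.max _ _ in rate_le *.
  have [nk|kn] := leqP n k0.
    have -> : k = n by apply/minn_idPl.
    rewrite divff ?gt_eqF//; apply: (@le_trans _ _ (1 - p)); last exact: ler_norm.
    have : Num.min 1 rate <= 1 by rewrite ge_min lexx.
    lra.
  have -> : k = k0 by apply/minn_idPr/ltnW.
  apply: (@le_trans _ _ (k0%:R / n%:R - p)); last exact: ler_norm.
  have : Num.min 1 rate <= rate by rewrite ge_min lexx orbT.
  have : r / n%:R <= k0%:R / n%:R by rewrite ler_pM2r ?invr_gt0// ltW.
  have : 2 * p <= r / n%:R by rewrite ler_pdivlMr//; lra.
  lra.
rewrite lerDl; apply: sumr_ge0 => i _; apply: binomial_pmf_ge0.
by apply/andP; split; lra.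
Qed.

Lemma binomial_anticoncentration (R : realType) :
  exists c b : R, [/\ 0 < c, 0 < b & forall (n j : nat) (p : R),
    (0 < n)%N -> 0 < p <= 2^-1 -> (2 * n%:R * j.+1%:R)^-1 <= p ->
    b / j.+1%:R <=
    \sum_(k < n.+1 | c * Num.min 1 (explicit_rate j.+1 p n) <=
        `|k%:R / n%:R - p|) binomial_pmf n p k].
Proof.
pose b1 := (1 - expR (- ((8 * 16)^-1 ^+ 2))) ^+ 2 / 2 : R.
pose b2 := expR (- 2) / 2 : R.
have b10 : 0 < b1.
  have e1 : expR (- ((8 * 16)^-1 ^+ 2)) < 1 :> R.
    by rewrite -[ltRHS]expR0 ltr_expR; lra.
  by rewrite /b1 divr_gt0// exprn_gt0// subr_gt0.
have b20 : 0 < b2 by apply: divr_gt0 => //; exact: expR_gt0.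
exists (32 * 32)^-1, (Num.min b1 b2); split.
- by lra.
- by rewrite lt_min b10.
- move=> n j p n0 p012 pj; case/andP: (p012) => p0 p1.
  have r0 : 0 <= Num.min 1 (explicit_rate j.+1 p n).
    by rewrite le_min ler01/= /explicit_rate le_max sqrtr_ge0.
  have mono (t : R) : (32 * 32)^-1 * Num.min 1 (explicit_rate j.+1 p n) <= t ->
      \sum_(k < n.+1 | t <= `|k%:R / n%:R - p|) binomial_pmf n p k <=
      \sum_(k < n.+1 | (32 * 32)^-1 * Num.min 1 (explicit_rate j.+1 p n) <=
        `|k%:R / n%:R - p|) binomial_pmf n p k.
    move=> tle; rewrite big_mkcond [leRHS]big_mkcond/=; apply: ler_sum => k _.
    have pk : 0 <= binomial_pmf n p k.
      by apply: binomial_pmf_ge0; apply/andP; split; lra.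
    case: ifPn => [h|_]; last by case: ifP.
    by rewrite ifT//; exact: le_trans h.
  have jV : 0 < (j.+1%:R : R)^-1 by rewrite invr_gt0 ltr0n.
  have [NL|NL] := leP (ln j.+2%:R) (16 ^+ 2 * (n%:R * p)).
    have gle : (32 * 32)^-1 * Num.min 1 (explicit_rate j.+1 p n) <=
        (32 * 32)^-1 * explicit_rate j.+1 p n.
      by rewrite ler_wpM2l ?ge_min ?lexx ?orbT// invr_ge0; lra.
    apply: le_trans (mono _ gle).
    apply: le_trans (gaussian_anticoncentration n0 p012 NL).
    rewrite (invfM 2) mulrA ler_pM2r//.
    by rewrite ge_min lexx.
  have ple : (32 * 32)^-1 * Num.min 1 (explicit_rate j.+1 p n) <=
      16^-1 * Num.min 1 (explicit_rate j.+1 p n).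
    by apply: ler_wpM2r => //; lra.
  apply: le_trans (mono _ ple).
  apply: le_trans (poisson_anticoncentration n0 p012 pj (ltW NL)).
  rewrite (invfM 2) mulrA ler_pM2r//.
  by rewrite ge_min lexx orbT.
Qed.

(** * Joint law of the numbers of successes *)

Lemma measurable_coordinate_preimage (j : nat) (B : set bool) :
  measurable (coordinate j @^-1` B : set cube).
Proof. by rewrite -[_ @^-1` _]setTI; exact: measurable_coordinate. Qed.

Section joint_law.
Context (R : realType) (p : nat -> R) (mu : probability cube R)
  (d : measure_display) (T : measurableType d) (P : probability T R) (n : nat)
  (X : 'I_n -> {RV P >-> cube}).
Context (p01 : forall j, 0 <= p j <= 1) (mup : product_bernoulli p mu)
  (Xmu : iid_sample X mu).

(** Keeping the set of successful trials, and not only its size, turns events into intersections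
    over the samples, to which independence applies. *)
Definition successes (j : nat) (w : T) : {set 'I_n} :=
  [set i | coordinate j (X i w)]%SET.

Lemma probability_coordinate (j : nat) (b : bool) :
  mu (coordinate j @^-1` [set b]) = (if b then p j else 1 - p j)%:E.
Proof.
have [_ /(_ j [set b])] := mup.
rewrite /distribution /pushforward => ->.
rewrite bernoulli_probE// !diracE /unstable.onem.
case: b.
- by rewrite [true \in _]mem_set// [false \in _]memNset// mule1 mule0 adde0.
- by rewrite [false \in _]mem_set// [true \in _]memNset// mule1 mule0 add0e.
Qed.

Section finite_family.
Context (m : nat) (g : 'I_m -> nat) (g_inj : injective g).

Let fiber (A : {ffun 'I_m -> {set 'I_n}}) : set T :=
  [set w | forall l, successes (g l) w = A l].

(** The condition ranges over preimages of [j] because [g] need not be surjective; at [g l],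
    injectivity makes the set a singleton. *)
Let pattern (A : {ffun 'I_m -> {set 'I_n}}) (i : 'I_n) (j : nat) : set bool :=
  [set b | forall l, g l = j -> b = (i \in A l)].

Let cylinder (A : {ffun 'I_m -> {set 'I_n}}) (i : 'I_n) : set cube :=
  \bigcap_(j in [set` map g (enum 'I_m)]) coordinate j @^-1` pattern A i j.

Let measurable_cylinder A i : measurable (cylinder A i).
Proof.
apply: fin_bigcap_measurable => // j _.
exact: measurable_coordinate_preimage.
Qed.

Let patternE A i l : pattern A i (g l) = [set i \in A l].
Proof.
apply/seteqP; split => [b /(_ l erefl)//|_ -> l' /g_inj ->//].
Qed.

Let fiberE A : fiber A = \bigcap_(i in [set` enum 'I_n]) X i @^-1` cylinder A i.
Proof.
apply/seteqP; split => w /=.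
- move=> h i _ j /= /mapP[l _ ->] /=; rewrite patternE/= -h inE//.
- move=> h l; apply/setP => i; rewrite inE.
  have := h i; rewrite /= mem_enum => /(_ isT (g l)) /=.
  rewrite patternE/=; apply.
  by apply/mapP; exists l; rewrite ?mem_enum.
Qed.

Let measurable_fiber A : measurable (fiber A).
Proof.
rewrite fiberE; apply: fin_bigcap_measurable => // i _.
exact: measurable_funPTI.
Qed.

Let probability_fiber A : P (fiber A) =
  (\prod_l \prod_i (if i \in A l then p (g l) else 1 - p (g l)))%:E.
Proof.
(* Independence is used twice: between the samples, then between the coordinates under [mu]. *)
have [Xind Xd] := Xmu; have [muind _] := mup.
rewrite fiberE Xind ?enum_uniq// exchange_big/= -prodEFin big_enum.
apply: eq_bigr => i _.
have := Xd i _ (measurable_cylinder A i).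
rewrite /distribution /pushforward => ->.
have -> := muind (map g (enum 'I_m)) (pattern A i).
- rewrite big_map big_enum -prodEFin.
  by apply: eq_bigr => l _; rewrite patternE probability_coordinate.
- by rewrite map_inj_uniq ?enum_uniq.
- by [].
Qed.

Lemma joint_binomial_law (B : 'I_m -> pred nat) :
  let E := [set w | forall l, B l #|successes (g l) w|] in
  measurable E /\
  P E = (\prod_l \sum_(k < n.+1 | B l k) binomial_pmf n (p (g l)) k)%:E.
Proof.
pose Q := family (fun l => [pred A : {set 'I_n} | B l #|A|]).
have -> : [set w | forall l, B l #|successes (g l) w|] =
    \bigcup_(A in [set` enum Q]) fiber A.
  apply/seteqP; split => w /=.
  - move=> h; exists [ffun l => successes (g l) w] => /=; last first.
      by move=> l; rewrite ffunE.
    by rewrite mem_enum; apply/familyP => l; rewrite ffunE; exact: h.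
  - by move=> [A /=]; rewrite mem_enum => /familyP h Aw l; rewrite Aw; exact: h.
split.
  by apply: fin_bigcup_measurable.
rewrite measure_fin_bigcup//; last first.
  move=> A A' _ _ [w [/= Aw A'w]]; apply/ffunP => l.
  by rewrite -Aw A'w.
rewrite -fsbig_seq ?enum_uniq//=.
under eq_bigr do rewrite probability_fiber.
rewrite sumEFin big_enum/=; congr EFin.
under [RHS]eq_bigr do rewrite -sum_set_binomial_pmf.
by rewrite bigA_distr_big_dep.
Qed.

End finite_family.
End joint_law.

(** * Bounds on the expected maximal deviation *)

Lemma min1_half_le_onem_expRN (R : realType) (y : R) : 0 <= y ->
  Num.min 1 y / 2 <= 1 - expR (- y).
Proof.
move=> y0; have y1 : 0 < 1 + y by lra.
have h : expR (- y) <= (1 + y)^-1.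
  by rewrite expRN lef_pV2 ?posrE ?expR_gt0// expR_ge1Dx.
have v1 : (1 + y) * (1 + y)^-1 = 1 by rewrite mulfV// gt_eqF.
have v0 : 0 < (1 + y)^-1 by rewrite invr_gt0.
suff : Num.min 1 y / 2 <= 1 - (1 + y)^-1 by lra.
move: ((1 + y)^-1) v1 v0 => v v1 v0.
by have [y2|y2] := leP 1 y; nra.
Qed.

Lemma sum_inv_sqr_le1 (R : realType) (m : nat) :
  \sum_(0 <= j < m) ((j.+2%:R : R) ^+ 2)^-1 <= 1.
Proof.
(* The strengthened bound telescopes, since [1 / (m + 2)^2 <= 1 / (m + 1) - 1 / (m + 2)]. *)
suff : \sum_(0 <= j < m) ((j.+2%:R : R) ^+ 2)^-1 <= 1 - m.+1%:R^-1.
  by move=> /le_trans; apply; rewrite lerBlDr lerDl.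
elim: m => [|m IH]; first by rewrite big_nil invr1 subrr.
rewrite big_nat_recr//=; apply: (le_trans (lerD IH (lexx _))).
have m0 : 0 < m.+1%:R :> R by rewrite ltr0n.
rewrite -[m.+2%:R]natr1; move: (m.+1%:R) m0 => x x0.
rewrite -subr_ge0.
have -> : 1 - (x + 1)^-1 - (1 - x^-1 + ((x + 1) ^+ 2)^-1) =
    (x * (x + 1) ^+ 2)^-1 by field; lra.
by rewrite invr_ge0; apply: mulr_ge0; [lra|exact: sqr_ge0].
Qed.

Section deviation.
Context (R : realType) (p : nat -> R) (mu : probability cube R)
  (d : measure_display) (T : measurableType d) (P : probability T R) (n : nat)
  (X : 'I_n -> {RV P >-> cube}).
Context (n_gt0 : (0 < n)%N) (p012 : forall j, 0 <= p j <= 2^-1)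
  (mup : product_bernoulli p mu) (Xmu : iid_sample X mu).

Let p01 j : 0 <= p j <= 1.
Proof. by have := p012 j; lra. Qed.

Let n0 : 0 < n%:R :> R. Proof. by rewrite ltr0n. Qed.

Let count (j : nat) (w : T) : nat := #|successes X j w|.

Let dev (j : nat) (w : T) : R := `|empirical_mean X j w - p j|.

Let maxdev (w : T) : R := sup (range (fun j => dev j w)).

Lemma empirical_meanE j w : empirical_mean X j w = (count j w)%:R / n%:R.
Proof.
rewrite /empirical_mean -natr_sum; congr (_%:R / _).
rewrite /count /successes -sum1dep_card [RHS]big_mkcond/=.
by apply: eq_bigr => i _; case: coordinate.
Qed.

Let count_le j w : (count j w <= n)%N.
Proof. by rewrite -[leqRHS]card_ord max_card. Qed.

Let devE j w : dev j w = `|(count j w)%:R / n%:R - p j|.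
Proof. by rewrite /dev empirical_meanE. Qed.

Let dev_le1 j w : dev j w <= 1.
Proof.
rewrite devE; have /andP[pj0 pj1] := p01 j.
have : (count j w)%:R / n%:R <= 1 :> R.
  by rewrite ler_pdivrMr// mul1r ler_nat count_le.
have : 0 <= (count j w)%:R / n%:R :> R by rewrite divr_ge0.
by rewrite ler_norml; lra.
Qed.

Let dev_ubound w : has_ubound (range (fun j => dev j w)).
Proof. by exists 1 => _ [j _ <-]; exact: dev_le1. Qed.

Let dev_le_maxdev j w : dev j w <= maxdev w.
Proof. by apply: ub_le_sup; [exact: dev_ubound|exists j]. Qed.

Let maxdev_le w y : (forall j, dev j w <= y) -> maxdev w <= y.
Proof.
move=> h; apply: ge_sup; first by exists (dev 0 w), 0%N.
by move=> _ [j _ <-].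
Qed.

Let maxdev_ge0 w : 0 <= maxdev w.
Proof. by apply: le_trans (dev_le_maxdev 0 w); exact: normr_ge0. Qed.

Let count_law j k : measurable [set w | count j w = k] /\
  P [set w | count j w = k] =
    (if (k < n.+1)%N then binomial_pmf n (p j) k else 0)%:E.
Proof.
have ginj : injective (fun _ : 'I_1 => j) by move=> x y; rewrite !ord1.
have [] := joint_binomial_law p01 mup Xmu ginj (fun _ => pred1 k).
have -> : [set w | forall l : 'I_1, pred1 k #|successes X j w|] =
    [set w | count j w = k].
  apply/seteqP; split => w /=; first by move=> /(_ ord0)/eqP.
  by move=> h l; apply/eqP.
move=> mE ->; split => //; rewrite big_ord1.
case: ifPn => kn.
  by rewrite (big_pred1 (Ordinal kn)).
rewrite big_pred0// => i; apply/negbTE; apply: contra kn => /eqP <-.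
exact: ltn_ord.
Qed.

(** This form as a simple function yields both measurability and the integral. *)
Let sum_indic_count (f : nat -> R) j w :
  f (count j w) = \sum_(k < n.+1) f k * \1_[set w | count j w = k] w.
Proof.
have kn : (count j w < n.+1)%N by rewrite ltnS.
rewrite (bigD1 (Ordinal kn))//= indicE mem_set// mulr1 big1 ?addr0// => i iN.
rewrite indicE memNset ?mulr0//= => ci.
by move/eqP: iN; apply; apply/val_inj.
Qed.

Lemma measurable_fun_count (f : nat -> R) j :
  measurable_fun setT (fun w => f (count j w)).
Proof.
under eq_fun do rewrite sum_indic_count.
apply: measurable_sum => k; apply: measurable_funM => //.
by apply: measurable_indic; have [] := count_law j k.
Qed.

Lemma integral_count (f : nat -> R) j : (forall k, 0 <= f k) ->
  (\int[P]_w (f (count j w))%:E =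
   (\sum_(k < n.+1) binomial_pmf n (p j) k * f k)%:E)%E.
Proof.
move=> f0.
under eq_integral do rewrite sum_indic_count -sumEFin.
rewrite ge0_integral_sum//=.
- rewrite -sumEFin; apply: eq_bigr => k _.
  have [mE PE] := count_law j k.
  under eq_integral do rewrite EFinM.
  rewrite ge0_integralZl_EFin//; last first.
    by apply/measurable_EFinP; exact: measurable_indic.
  rewrite integral_indic// setIT.
  rewrite [X in (_ * X)%E]PE ltn_ord -EFinM.
  by congr EFin; rewrite mulrC.
- move=> k; apply/measurable_EFinP; apply: measurable_funM => //.
  by apply: measurable_indic; have [] := count_law j k.
- by move=> k w _; rewrite lee_fin mulr_ge0.
Qed.

Let measurable_maxdev : measurable_fun setT maxdev.
Proof.
have -> : maxdev = fun w => sups (fun j => dev j w) 0%N.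
  apply/funext => w; rewrite /sups/= /maxdev; congr sup.
  by apply/seteqP; split => _ [j _ <-]; exists j.
apply: (@measurable_fun_sups _ _ _ setT dev) => [w _|j]; first exact: dev_ubound.
have -> : dev j = fun w => `|(count j w)%:R / n%:R - p j|.
  by apply/funext => w; rewrite devE.
exact: (measurable_fun_count (fun k => `|k%:R / n%:R - p j|)).
Qed.

Let deviationE : (expected_max_deviation X p = \int[P]_w (maxdev w)%:E)%E.
Proof. by rewrite /expected_max_deviation unlock. Qed.

Lemma expected_max_deviation_ge0 : (0 <= expected_max_deviation X p)%E.
Proof.
by rewrite deviationE; apply: integral_ge0 => w _; rewrite lee_fin maxdev_ge0.
Qed.

Lemma expected_max_deviation_le1 : (expected_max_deviation X p <= 1)%E.
Proof.
rewrite deviationE.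
apply: (@le_trans _ _ (\int[P]_w (cst 1%E w)))%E.
  apply: ge0_le_integral => //=.
  - by move=> w _; rewrite lee_fin.
  - exact/measurable_EFinP.
  - by move=> w _; rewrite lee_fin maxdev_le.
by rewrite integral_cst//= probability_setT mule1.
Qed.

(* The maximum is dominated by a series of nonnegative functions of the single
   coordinates, so that no tail needs to be integrated. *)
Lemma expected_max_deviation_le_series (s : R) (b : nat -> nat -> R) :
    0 <= s -> (forall j k, 0 <= b j k) ->
    (forall j k, (k <= n)%N -> `|k%:R / n%:R - p j| <= s + b j k) ->
  (expected_max_deviation X p <=
   s%:E + \sum_(0 <= j <oo)
     (\sum_(k < n.+1) binomial_pmf n (p j) k * b j k)%:E)%E.
Proof.
move=> s0 b0 h; rewrite deviationE.
pose g j w := (b j (count j w))%:E.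
have mg j : measurable_fun setT (g j).
  by apply/measurable_EFinP; exact: (measurable_fun_count (b j)).
have g0 j w : (0 <= g j w)%E by rewrite lee_fin.
have ms : measurable_fun setT (fun w => \sum_(0 <= j <oo) g j w)%E.
  exact: ge0_emeasurable_sum.
apply: (@le_trans _ _ (\int[P]_w (cst s%:E w + \sum_(0 <= j <oo) g j w)))%E.
  apply: ge0_le_integral => //=.
  - by move=> w _; rewrite lee_fin.
  - exact/measurable_EFinP.
  - by apply: emeasurable_funD.
  - move=> w _.
    have S0 : (0 <= \sum_(0 <= j <oo) g j w)%E by apply: nneseries_ge0.
    case E : (\sum_(0 <= j <oo) g j w)%E S0 => [r| |] // S0; last by rewrite leey.
    rewrite -EFinD lee_fin; apply: maxdev_le => j.
    rewrite devE; apply: le_trans (h _ _ (count_le j w)) _; rewrite lerD2l.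
    (* The partial sum of the first [j + 1] terms includes the term of index [j]. *)
    have := @nneseries_lim_ge R (g ^~ w) xpredT 0%N j.+1 (fun i _ _ => g0 i w).
    rewrite E -lee_fin => /(le_trans _); apply.
    by rewrite big_nat_recr//= leeDr// sume_ge0.
rewrite ge0_integralD//=.
- rewrite integral_cst//= probability_setT mule1 leeD2l//.
  rewrite integral_nneseries//.
  by under eq_eseriesr do rewrite /g (integral_count _ (b0 _)).
- by move=> w _; apply: nneseries_ge0.
Qed.

Lemma expected_max_deviation_le_rate (s : R) : 0 < s ->
    (forall j, 16 * explicit_rate j.+1 (p j) n <= s) ->
  (expected_max_deviation X p <= (3 * s)%:E)%E.
Proof.
move=> s0 hs.
(* [chernoff_tilt] is applied with [u = L / n], so [m] is the tilt of a single sample and [n m] is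
   the [l_j] of the overview. The bound [n m s >= 1] follows from [n m s >= 4 L] and [L >= 1/2]. *)
have : forall j, exists m : R, [/\ 0 < m, 1 <= n%:R * m * s,
    n%:R * p j * (expR m - 1 - m) - n%:R * m * s <= - 2 * ln j.+2%:R &
    n%:R * p j * (expR (- m) - 1 + m) - n%:R * m * s <= - 2 * ln j.+2%:R].
  move=> j; have L1 := @ln_natSS_ge R j.
  have /andP[pj0 _] := p012 j.
  have := hs j; rewrite /explicit_rate; set L := ln _ in L1 *.
  move=> hj; have u0 : 0 < L / n%:R by apply: divr_gt0 => //; lra.
  have [||m [m0 m1 m2 m3]] := chernoff_tilt pj0 s0 u0.
  - by apply: le_trans hj; rewrite mulrA ler_pM2l// le_max lexx.
  - move=> pjN; apply: le_trans hj; rewrite (negbTE pjN) ler_pM2l// le_max.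
    by rewrite !invfM !mulrA lexx orbT.
  have LE : n%:R * (L / n%:R) = L by rewrite mulrC divfK// gt_eqF.
  move: (L / n%:R) LE u0 m1 m2 m3 => u LE u0 m1 m2 m3.
  exists m; split => //.
  - have : n%:R * (4 * u) <= n%:R * (m * s) by rewrite ler_pM2l.
    lra.
  - have := ler_wpM2l (ltW n0) m2; lra.
  - have := ler_wpM2l (ltW n0) m3; lra.
move=> /choice[m hm].
(* By [1 + x <= exp x], each exponential divided by [n m] dominates one sign of the deviation minus
   [s]. *)
pose b j (k : nat) := (n%:R * m j)^-1 *
  (expR (m j * k%:R - n%:R * m j * (p j + s)) +
   expR (- m j * k%:R + n%:R * m j * (p j - s))).
apply: (@le_trans _ _ (s%:E + \sum_(0 <= j <oo)
     (\sum_(k < n.+1) binomial_pmf n (p j) k * b j k)%:E)%E).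
  apply: expected_max_deviation_le_series; first exact: ltW.
    move=> j k; have [m0 _ _ _] := hm j.
    by rewrite mulr_ge0 ?invr_ge0 ?mulr_ge0 ?addr_ge0 ?expR_ge0// ltW.
  move=> j k kn; have [m0 _ _ _] := hm j.
  have l0 : 0 < n%:R * m j by rewrite mulr_gt0.
  have e1 := expR_ge1Dx (m j * k%:R - n%:R * m j * (p j + s)).
  have e2 := expR_ge1Dx (- m j * k%:R + n%:R * m j * (p j - s)).
  have e3 := expR_ge0 (m j * k%:R - n%:R * m j * (p j + s)).
  have e4 := expR_ge0 (- m j * k%:R + n%:R * m j * (p j - s)).
  rewrite -lerBlDl /b ler_pdivlMl//.
  have kE : (k%:R / n%:R - p j) * (n%:R * m j) = m j * k%:R - n%:R * m j * p j.
    by field; rewrite gt_eqF.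
  by have [z0|z0] := ger0P (k%:R / n%:R - p j); lra.
have bound j : \sum_(k < n.+1) binomial_pmf n (p j) k * b j k <=
    2 * s * (j.+2%:R ^+ 2)^-1.
  have [m0 ms m1 m2] := hm j.
  have l0 : 0 < n%:R * m j by rewrite mulr_gt0.
  have lV : (n%:R * m j)^-1 <= s by rewrite -[leLHS]mul1r ler_pdivrMr// mulrC.
  have jE : (j.+2%:R ^+ 2)^-1 = expR (- 2 * ln j.+2%:R) :> R.
    by rewrite mulNr expRN expRM_natl lnK// posrE ltr0n.
  pose e1 := expR (- (n%:R * m j * (p j + s))).
  pose e2 := expR (n%:R * m j * (p j - s)).
  have -> : \sum_(k < n.+1) binomial_pmf n (p j) k * b j k =
      (n%:R * m j)^-1 *
      (e1 * (\sum_(k < n.+1) binomial_pmf n (p j) k * expR (m j * k%:R)) +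
       e2 * (\sum_(k < n.+1) binomial_pmf n (p j) k * expR (- m j * k%:R))).
    rewrite !mulr_sumr -big_split/= mulr_sumr; apply: eq_bigr => k _.
    by rewrite /b !expRD /e1 /e2; ring.
  have t1 : e1 * (\sum_(k < n.+1) binomial_pmf n (p j) k * expR (m j * k%:R)) <=
      (j.+2%:R ^+ 2)^-1.
    apply: le_trans (_ : e1 * expR (n%:R * p j * (expR (m j) - 1)) <= _).
      by rewrite ler_pM2l ?expR_gt0// sum_binomial_pmf_expR.
    by rewrite -expRD jE ler_expR; lra.
  have t2 : e2 * (\sum_(k < n.+1) binomial_pmf n (p j) k * expR (- m j * k%:R)) <=
      (j.+2%:R ^+ 2)^-1.
    apply: le_trans (_ : e2 * expR (n%:R * p j * (expR (- m j) - 1)) <= _).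
      by rewrite ler_pM2l ?expR_gt0// sum_binomial_pmf_expR.
    by rewrite -expRD jE ler_expR; lra.
  have -> : 2 * s * (j.+2%:R ^+ 2)^-1 = s * (2 * (j.+2%:R ^+ 2)^-1) by ring.
  apply: ler_pM => //; [by rewrite invr_ge0 ltW| |by rewrite mulr_natl mulr2n lerD].
  by rewrite addr_ge0// mulr_ge0 ?expR_ge0// sumr_ge0// => k _;
    rewrite mulr_ge0 ?expR_ge0// binomial_pmf_ge0.
have b0 j k : 0 <= b j k.
  have [m0 _ _ _] := hm j.
  by rewrite mulr_ge0 ?invr_ge0 ?mulr_ge0 ?addr_ge0 ?expR_ge0// ltW.
have -> : (3 * s)%:E = (s%:E + (2 * s)%:E)%E by rewrite -EFinD; congr EFin; ring.
rewrite leeD2l//; apply: lime_le.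
  apply: is_cvg_nneseries => j _ _; rewrite lee_fin sumr_ge0// => k _.
  by rewrite mulr_ge0// binomial_pmf_ge0.
apply: nearW => N; rewrite sumEFin lee_fin.
apply: (@le_trans _ _ (\sum_(0 <= j < N) 2 * s * (j.+2%:R ^+ 2)^-1)).
  by apply: ler_sum => j _; exact: bound.
rewrite -mulr_sumr ler_piMr ?sum_inv_sqr_le1//; lra.
Qed.

(** The deviation of a coordinate is at most [k / n + p j], and [k <= 2 (exp (k / 2) - 1)] reduces
    its mean to the Laplace transform at 1/2. That is at most [exp (n p) <= 1 + 2 n p], so the mean
    is at most [4 p + p]. *)
Lemma expected_max_deviation_le_sum : (forall j, n%:R * p j <= 2^-1) ->
  (expected_max_deviation X p <= 5%:E * \sum_(0 <= j <oo) (p j)%:E)%E.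
Proof.
move=> np; pose b j (k : nat) := 2 / n%:R * (expR (2^-1 * k%:R) - 1) + p j.
have e1 (k : nat) : 2^-1 * k%:R <= expR (2^-1 * k%:R) - 1 :> R.
  by have := @expR_ge1Dx R (2^-1 * k%:R); lra.
have k0 (k : nat) : 0 <= k%:R :> R by rewrite ler0n.
have nV : 0 < n%:R^-1 :> R by rewrite invr_gt0.
have kb j (k : nat) : k%:R / n%:R + p j <= b j k.
  rewrite /b lerD2r.
  have : n%:R^-1 * (2^-1 * k%:R) <= n%:R^-1 * (expR (2^-1 * k%:R) - 1) :> R.
    by rewrite ler_pM2l.
  lra.
have kn0 (k : nat) : 0 <= k%:R / n%:R :> R by rewrite divr_ge0.
have b0 j k : 0 <= b j k.
  by apply: le_trans (kb j k); have := p012 j; have := kn0 k; lra.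
rewrite -nneseriesZl//; last by move=> j _; rewrite lee_fin; have := p012 j; lra.
apply: (@le_trans _ _ (0%:E + \sum_(0 <= j <oo)
     (\sum_(k < n.+1) binomial_pmf n (p j) k * b j k)%:E)%E).
  apply: expected_max_deviation_le_series => // j k _; rewrite add0r.
  apply: le_trans (kb j k); have := p012 j; have := kn0 k.
  by rewrite ler_norml; lra.
rewrite add0e; apply: lee_nneseries => [j _|j _].
  by rewrite lee_fin sumr_ge0// => k _; rewrite mulr_ge0// binomial_pmf_ge0.
have /andP[pj0 _] := p012 j.
rewrite -EFinM lee_fin.
have -> : \sum_(k < n.+1) binomial_pmf n (p j) k * b j k =
    2 / n%:R * (\sum_(k < n.+1) binomial_pmf n (p j) k * expR (2^-1 * k%:R)) +
    (p j - 2 / n%:R) * \sum_(k < n.+1) binomial_pmf n (p j) k.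
  rewrite !mulr_sumr -big_split/=; apply: eq_bigr => k _; rewrite /b; ring.
rewrite sum_binomial_pmf mulr1.
have h1 : \sum_(k < n.+1) binomial_pmf n (p j) k * expR (2^-1 * k%:R) <=
    expR (n%:R * p j).
  apply: le_trans (sum_binomial_pmf_expR _ _ (p01 j)) _.
  rewrite ler_expR ler_piMr ?mulr_ge0 ?ler0n//.
  have : expR (2^-1) <= 1 + 2^-1 + 2 * 2^-1 ^+ 2 :> R.
    by apply: expR_le_quadratic; apply/andP; split; lra.
  lra.
have h2 : expR (n%:R * p j) <= 1 + 2 * (n%:R * p j).
  have np0 : 0 <= n%:R * p j by rewrite mulr_ge0.
  have : expR (n%:R * p j) <= 1 + n%:R * p j + 2 * (n%:R * p j) ^+ 2.
    by apply: expR_le_quadratic; rewrite np0 np.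
  have := np j; nra.
have : 2 / n%:R * (\sum_(k < n.+1) binomial_pmf n (p j) k * expR (2^-1 * k%:R))
    <= 2 / n%:R * (1 + 2 * (n%:R * p j)).
  by rewrite ler_wpM2l ?divr_ge0//; exact: le_trans h2.
have -> : 2 / n%:R * (1 + 2 * (n%:R * p j)) = 2 / n%:R + 4 * p j.
  by field; rewrite gt_eqF.
lra.
Qed.

(** By independence, the probability that none of the first [m] coordinates deviates by [t] is a
    product of factors at most [exp (- q j)]; off that event the maximum is at least [t]. *)
Lemma expected_max_deviation_ge (t : R) (m : nat) (q : nat -> R) : 0 <= t ->
    (forall j, (j < m)%N ->
      \sum_(k < n.+1 | ~~ (t <= `|k%:R / n%:R - p j|)) binomial_pmf n (p j) k <=
      expR (- q j)) ->
  ((t * (1 - expR (- \sum_(0 <= j < m) q j)))%:E <=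
   expected_max_deviation X p)%E.
Proof.
move=> t0 h; rewrite deviationE.
have ginj : injective (fun l : 'I_m => l : nat) by exact: val_inj.
have [] := joint_binomial_law p01 mup Xmu ginj
  (fun l k => ~~ (t <= `|k%:R / n%:R - p l|)).
set E := [set w | _] => mE PE.
apply: (@le_trans _ _ (\int[P]_w (t%:E * (\1_(~` E) w)%:E)))%E; last first.
  apply: ge0_le_integral => //=.
  - by move=> w _; rewrite mule_ge0// lee_fin.
  - apply: emeasurable_funM => //; apply/measurable_EFinP.
    by apply: measurable_indic; exact: measurableC.
  - exact/measurable_EFinP.
  - move=> w _; rewrite -EFinM lee_fin.
    have [Ew|nEw] := pselect (E w).
      by rewrite indicE memNset ?mulr0//= => /(_ Ew).
    rewrite indicE mem_set// mulr1.
    move: nEw => /existsNP[l /negP]; rewrite negbK => tl.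
    by apply: le_trans tl _; rewrite -devE.
rewrite ge0_integralZl_EFin//; last first.
  apply/measurable_EFinP.
  by apply: measurable_indic; exact: measurableC.
rewrite integral_indic//; last exact: measurableC.
rewrite setIT [X in (_ * X)%E](probability_setC _ mE) [X in (_ - X)%E]PE.
rewrite -EFinB -EFinM lee_fin.
rewrite ler_wpM2l// lerB// big_mkord -sumrN expR_sum.
apply: ler_prod => l _; rewrite h// andbT.
by apply: sumr_ge0 => k _; exact: binomial_pmf_ge0.
Qed.

End deviation.

(** * Comparison of the rates *)

Lemma explicit_rate_ge0 (R : realType) (J n : nat) (q : R) :
  0 <= explicit_rate J q n.
Proof. by rewrite /explicit_rate le_max sqrtr_ge0. Qed.

Lemma le_explicit_rate (R : realType) (j n : nat) (q q' : R) :
  (0 < n)%N -> 0 < q -> q <= q' ->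
  explicit_rate j.+1 q n <= explicit_rate j.+1 q' n.
Proof.
move=> n_gt0 q0 qq'; rewrite /explicit_rate.
have := @ln_natSS_ge R j; set L := ln _ => L1.
have n0 : 0 < n%:R :> R by rewrite ltr0n.
have q'0 : 0 < q' by lra.
have L0 : 0 < L by lra.
rewrite !gt_eqF// ge_max !le_max; apply/andP; split; apply/orP.
  by left; rewrite ler_wsqrtr// ler_pM2r ?invr_gt0// ler_pM2r.
right; have x0 : 0 <= L / (n%:R * q') by rewrite divr_ge0 ?mulr_ge0// ltW.
have xx : L / (n%:R * q') <= L / (n%:R * q).
  by rewrite ler_pM2l// lef_pV2 ?posrE ?mulr_gt0// ler_pM2l.
have l0 : 0 < ln (2 + L / (n%:R * q')) by apply: ln_gt0; lra.
have l1 : ln (2 + L / (n%:R * q')) <= ln (2 + L / (n%:R * q)).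
  by rewrite ler_ln ?posrE; lra.
rewrite ler_pM2l// lef_pV2 ?posrE ?ler_pM2l// mulr_gt0//.
exact: lt_le_trans l1.
Qed.

(** For the square root, [L <= j + 1] gives [q L n <= 1]. For the other term,
    [L / (n q) >= 2 (j + 1) L >= j + 1] makes the logarithm at least [L]. *)
Lemma explicit_rate_le_inv (R : realType) (j n : nat) (q : R) : (0 < n)%N ->
    0 <= q -> q <= (2 * n%:R * j.+1%:R)^-1 ->
  explicit_rate j.+1 q n <= n%:R^-1.
Proof.
move=> n_gt0 q0 qj; rewrite /explicit_rate.
have := @ln_natSS_ge R j; have := @ln_natSS_le R j.
have eL : expR (ln j.+2%:R) = j.+2%:R :> R by rewrite lnK// posrE ltr0n.
set L := ln _ in eL *.
have n0 : 0 < n%:R :> R by rewrite ltr0n.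
have j0 : 0 < j.+1%:R :> R by rewrite ltr0n.
have jj : j.+2%:R = j.+1%:R + 1 :> R by rewrite natr1.
rewrite jj in eL.
have qE : q * (2 * n%:R * j.+1%:R) <= 1.
  have h : 0 < 2 * n%:R * j.+1%:R :> R by rewrite !mulr_gt0.
  by rewrite -ler_pdivlMr// div1r.
move: (j.+1%:R) j0 eL qE {qj jj} => r j0 eL qE L2 L1.
have r1 : 0 < expR L by exact: expR_gt0.
rewrite ge_max; apply/andP; split.
  rewrite [leRHS](_ : _ = Num.sqrt (n%:R^-1 ^+ 2)); last first.
    by rewrite sqrtr_sqr gtr0_norm// invr_gt0.
  apply: ler_wsqrtr; rewrite expr2 ler_pM2r ?invr_gt0//.
  rewrite -[leRHS]mul1r ler_pdivlMr//.
  have : q * n%:R * L <= q * n%:R * r by rewrite ler_wpM2l// mulr_ge0// ltW.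
  lra.
case: eqVneq => [_|qN]; first by rewrite invr_ge0 ltW.
have {qN}q0 : 0 < q by rewrite lt0r qN.
have x2 : 2 * r * L <= L / (n%:R * q).
  rewrite ler_pdivlMr ?mulr_gt0//.
  have := ler_wpM2l (_ : 0 <= L) qE; rewrite mulr1 => /(_ _).
  by move=> h; apply: le_trans (h _); lra.
have lL : L <= ln (2 + L / (n%:R * q)).
  have x0 : 0 <= 2 * r * L by rewrite !mulr_ge0//; lra.
  by rewrite -[leLHS]expRK ler_ln ?posrE//; [rewrite eL; nra|lra].
rewrite invfM mulrCA ler_piMr ?invr_ge0 ?(ltW n0)//.
by rewrite ler_pdivrMr ?mul1r//; lra.
Qed.

(** The logarithmic term alone suffices: [L / (n q) <= 2 (j + 1) L <= 2 (j + 1)^2], so its logarithm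
    is at most [ln (2 (j + 2)^2) <= 3 L]. *)
Lemma explicit_rate_ge_inv (R : realType) (j n : nat) (q : R) : (0 < n)%N ->
    (2 * n%:R * j.+1%:R)^-1 <= q ->
  (3 * n%:R)^-1 <= explicit_rate j.+1 q n.
Proof.
move=> n_gt0 qj; rewrite /explicit_rate.
have := @ln_natSS_ge R j; have := @ln_natSS_le R j.
have j2 : (1 : R) < j.+2%:R by rewrite ltr1n.
have l2 : ln (2 * j.+2%:R ^+ 2) = ln 2 + 2 * ln j.+2%:R :> R.
  by rewrite lnM ?posrE ?exprn_gt0 ?ltr0n// lnXn ?ltr0n// mulr_natl.
have l22 : ln 2 <= ln j.+2%:R :> R by rewrite ler_ln ?posrE ?ltr0n// ler_nat.
set L := ln j.+2%:R in l2 l22 *.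
have n0 : 0 < n%:R :> R by rewrite ltr0n.
have j0 : 0 < j.+1%:R :> R by rewrite ltr0n.
have m0 : 0 < 2 * n%:R * j.+1%:R :> R by rewrite !mulr_gt0.
have q0 : 0 < q by apply: lt_le_trans qj; rewrite invr_gt0.
have qE : 1 <= q * (2 * n%:R * j.+1%:R).
  by rewrite -ler_pdivrMr// div1r.
have jj : j.+2%:R = j.+1%:R + 1 :> R by rewrite natr1.
rewrite jj in j2 l2.
move: (j.+1%:R) j0 j2 l2 qE {qj jj m0} => r j0 j2 l2 qE L2 L1.
rewrite gt_eqF// le_max; apply/orP; right.
have x0 : 0 <= L / (n%:R * q) by rewrite divr_ge0 ?mulr_ge0// ltW//; lra.
have xle : L / (n%:R * q) <= 2 * r * L.
  rewrite ler_pdivrMr ?mulr_gt0//.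
  have := ler_wpM2l (_ : 0 <= L) qE; rewrite mulr1 => /(_ _) h.
  by apply: (le_trans (h _)); lra.
have lle : ln (2 + L / (n%:R * q)) <= 3 * L.
  apply: (@le_trans _ _ (ln (2 * (r + 1) ^+ 2))); last lra.
  by rewrite ler_ln ?posrE; nra.
have l0 : 0 < ln (2 + L / (n%:R * q)) by apply: ln_gt0; lra.
rewrite ler_pdivlMr ?mulr_gt0//; move: (ln _) lle l0 => l lle l0.
have -> : (3 * n%:R)^-1 * (n%:R * l) = l / 3 by field; rewrite gt_eqF.
lra.
Qed.

Lemma le_mul2_min1 (R : realType) (a m : R) :
  a <= 2 -> a <= 2 * m -> a <= 2 * Num.min 1 m.
Proof. by move=> a2 am; case: (leP 1 m) => _; rewrite ?mulr1. Qed.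

Lemma phi_explicit_rate (R : realType) (j n : nat) (q : R) : (0 < n)%N ->
    0 <= q <= 2^-1 ->
  [/\ 0 <= phi j.+1 q n, phi j.+1 q n <= 2 * Num.min 1 (explicit_rate j.+1 q n) &
    Num.min 1 (explicit_rate j.+1 q n) <= 4 * phi j.+1 q n].
Proof.
move=> n_gt0 /andP[q0 q1]; rewrite /phi /explicit_rate.
case: eqVneq => [->|qN].
  by rewrite !mul0r sqrtr0 maxxx min_r ?ler01// !mulr0 lexx.
have {qN}q0 : 0 < q by rewrite lt0r qN.
have n0 : 0 < n%:R :> R by rewrite ltr0n.
have := @ln_natSS_ge R j; set L := ln j.+2%:R => L1; clearbody L.
have L0 : 0 < L by lra.
(* In terms of [u = L / n] the cases of [phi] become [- ln q <= u], then [exp 1 <= u / q], then the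
   rest. *)
have [u [u0 LE]] : exists u, 0 < u /\ L = n%:R * u.
  by exists (L / n%:R); rewrite divr_gt0// mulrC divfK// gt_eqF.
have -> : q * L / n%:R = q * u by rewrite LE; field; rewrite gt_eqF.
have xE : L / (n%:R * q) = u / q by rewrite LE; field; rewrite !gt_eqF.
rewrite !xE.
have rE t : L / (n%:R * t) = u / t.
  by rewrite LE invfM mulrACA mulfV ?gt_eqF// mul1r.
rewrite !rE.
have x0 : 0 < u / q by exact: divr_gt0.
have e2 : 2 <= expR 1 :> R by have := @expR_ge1Dx R 1; lra.
have e4 : expR 1 <= 4 :> R.
  have -> : 1 = 2^-1 + 2^-1 :> R by lra.
  rewrite expRD; have := @expR_le_quadratic R 2^-1.
  have := expR_ge0 (2^-1 : R); move: (expR _) => e; nra.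
have ql : ln q^-1 = - ln q by rewrite lnV// posrE.
have l2 : 2^-1 <= - ln q.
  have := ln_le_subr1 q0; lra.
have lx : ln (u / q) = ln u - ln q by rewrite ln_div ?posrE.
have l2x : ln (2 + u / q) = ln (2 * q + u) - ln q.
  by rewrite -ln_div ?posrE//; [congr ln; field; lra|lra].
have l0 : 0 < ln (2 + u / q) by apply: ln_gt0; lra.
have s0 : 0 <= Num.sqrt (q * u) by exact: sqrtr_ge0.
rewrite ql ler_pdivlMr; last lra.
have -> : (n%:R * - ln q <= L) = (- ln q <= u) by rewrite LE ler_pM2l.
have [ul|ul] := leP (- ln q) u.
  (* Here [ln (2 q + u) <= 2 q + u - 1 <= u] and [- ln q <= u], so the logarithm is at most
     [2 u]. *)
  have h : 2^-1 <= u / ln (2 + u / q).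
    rewrite ler_pdivlMr// l2x.
    have : 0 < 2 * q + u by lra.
    by move=> /ln_le_subr1; lra.
  split; [by []| |by apply: (@le_trans _ _ 1); [rewrite ge_min lexx|lra]].
  apply: le_mul2_min1; first lra.
  by rewrite -ler_pdivrMl// mulr1 le_max h orbT.
have -> : (n%:R <= L / (expR 1 * q)) = (expR 1 <= u / q).
  rewrite ler_pdivlMr; last by apply: mulr_gt0; lra.
  by rewrite LE ler_pM2l// ler_pdivlMr.
have [ux|ux] := leP (expR 1) (u / q).
  have lx1 : 1 <= ln (u / q).
    by rewrite -[leLHS]expRK ler_ln ?posrE ?expR_gt0.
  have phi1 : u / ln (u / q) <= 1.
    rewrite ler_pdivrMr ?mul1r; last lra.
    have [u1|u1] := leP u 1; first lra.
    by have := ln_ge0 (ltW u1); lra.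
  have phi0 : 0 < u / ln (u / q) by apply: divr_gt0; lra.
  (* For [x >= 2] one has [2 + x <= x^2], hence [ln (2 + x) <= 2 ln x]. *)
  have h1 : u / ln (u / q) / 2 <= u / ln (2 + u / q).
    rewrite -mulrA ler_pM2l// -invfM lef_pV2 ?posrE//; last lra.
    rewrite mulr_natr -lnXn// ler_ln ?posrE; [|lra|exact: exprn_gt0].
    move: (u / q) ux => x ux; have : 2 <= x by lra.
    nra.
  have h2 : u / ln (2 + u / q) <= u / ln (u / q).
    by rewrite ler_pM2l// lef_pV2 ?posrE// ?ler_ln ?posrE; lra.
  have h3 : Num.sqrt (q * u) <= 2 * (u / ln (u / q)).
    rewrite mulrA ler_pdivlMr; last lra.
    have sE : Num.sqrt (q * u) * Num.sqrt (u / q) = u.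
      rewrite -sqrtrM; last by rewrite mulr_ge0; lra.
      have -> : q * u * (u / q) = u ^+ 2 by field; lra.
      by rewrite sqrtr_sqr gtr0_norm.
    have := ler_wpM2l s0 (ln_le_sqrt x0); lra.
  split; first exact: ltW.
    apply: le_mul2_min1; first lra.
    rewrite -ler_pdivrMl// le_max; apply/orP; right; lra.
  apply: (@le_trans _ _ (Num.max (Num.sqrt (q * u)) (u / ln (2 + u / q)))).
    by rewrite ge_min lexx orbT.
  by rewrite ge_max; apply/andP; split; lra.
have uq : u <= 4 * q.
  move: ux; rewrite ltr_pdivrMr//.
  have := ler_wpM2r (ltW q0) e4; lra.
have sq := sqr_sqrtr (ltW (mulr_gt0 q0 u0)).
have s1 : Num.sqrt (q * u) <= 1.
  by rewrite -[leRHS]sqrtr1 ler_wsqrtr//; nra.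
have us : u <= 2 * Num.sqrt (q * u).
  rewrite -ler_sqr ?nnegrE; [|lra|lra].
  rewrite exprMn sq; nra.
have l22 : 2^-1 <= ln (2 + u / q).
  apply: le_trans (@ln_natSS_ge R 0) _.
  by rewrite ler_ln ?posrE ?ltr0n//; lra.
have h : u / ln (2 + u / q) <= 4 * Num.sqrt (q * u).
  by rewrite ler_pdivrMr//; nra.
split => //.
  apply: le_mul2_min1; first lra.
  rewrite -ler_pdivrMl// le_max; apply/orP; left; lra.
apply: (@le_trans _ _ (Num.max (Num.sqrt (q * u)) (u / ln (2 + u / q)))).
  by rewrite ge_min lexx orbT.
by rewrite ge_max h andbT; lra.
Qed.

Lemma ereal_sup_bounded (R : realType) (f : nat -> R) (B : R) :
    (forall j, 0 <= f j <= B) ->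
  exists y : R, [/\ ereal_sup (range (fun j => (f j)%:E)) = y%:E,
    forall j, f j <= y & forall t, (forall j, f j <= t) -> y <= t].
Proof.
move=> fB.
have lb j : ((f j)%:E <= ereal_sup (range (fun j => (f j)%:E)))%E.
  by apply: ereal_sup_ubound; exists j.
have ub t : (forall j, f j <= t) ->
    (ereal_sup (range (fun j => (f j)%:E)) <= t%:E)%E.
  by move=> ft; apply: ge_ereal_sup => _ [j _ <-]; rewrite lee_fin.
have := ub B (fun j => proj2 (andP (fB j))); have := lb 0%N.
case E : ereal_sup => [y| |]// _ _; exists y; split => // [j|t ft].
  by have := lb j; rewrite E lee_fin.
by have := ub t ft; rewrite E lee_fin.
Qed.

(** Moving the cap inside leaves a bounded family, whose supremum is a real number. *)
Lemma mine_ereal_sup (R : realType) (f : nat -> R) : (forall j, 0 <= f j) ->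
  mine 1%:E (ereal_sup (range (fun j => (f j)%:E))) =
  ereal_sup (range (fun j => (Num.min 1 (f j))%:E)).
Proof.
move=> f0; apply/le_anti/andP; split; last first.
  apply: ge_ereal_sup => _ [j _ <-]; rewrite le_min lee_fin ge_min lexx/=.
  apply: (@le_trans _ _ (f j)%:E); first by rewrite lee_fin ge_min lexx orbT.
  by apply: ereal_sup_ubound; exists j.
set t := (X in (_ <= X)%E); rewrite ge_min.
have [h|h] := leP (ereal_sup (range (fun j => (f j)%:E))) t.
  by rewrite orbT.
have [_ [j _ <-] tj] := ereal_sup_gt h.
have : ((Num.min 1 (f j))%:E <= t)%E by apply: ereal_sup_ubound; exists j.
rewrite EFin_min ge_min => /orP[->//|]; by rewrite leNgt tj.
Qed.

(** * Lower bounds in the two regimes and the final assembly *)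

Lemma expected_max_deviation_ge_rate (R : realType) :
  exists k : R, 0 < k /\
  forall (n : nat) (p : nat -> R), (0 < n)%N ->
    (forall j, 0 <= p j <= 2^-1) -> (forall j, p j.+1 <= p j) ->
  forall (mu : probability cube R) (d : measure_display) (T : measurableType d)
    (P : probability T R) (X : 'I_n -> {RV P >-> cube}),
    product_bernoulli p mu -> iid_sample X mu ->
  forall j, (2 * n%:R * j.+1%:R)^-1 <= p j ->
  ((k * Num.min 1 (explicit_rate j.+1 (p j) n))%:E <=
   expected_max_deviation X p)%E.
Proof.
have [c [b [c0 b0 H]]] := binomial_anticoncentration R.
have e1 : expR (- b) < 1 by rewrite -[ltRHS]expR0 ltr_expR; lra.
exists (c * (1 - expR (- b))); split; first by apply: mulr_gt0; lra.
move=> n p n_gt0 p012 pdec mu d T P X mup Xmu j pj.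
have n0 : 0 < n%:R :> R by rewrite ltr0n.
have pj0 : 0 < p j.
  by apply: lt_le_trans pj; rewrite invr_gt0 !mulr_gt0// ltr0n.
have pmono i : (i <= j)%N -> p j <= p i.
  by move=> ij; apply: (@homo_leq _ p (fun x y => y <= x)) ij => // x y z;
    exact: ge_trans.
set r := Num.min 1 _.
have r0 : 0 <= r by rewrite le_min ler01 explicit_rate_ge0.
have bE : \sum_(0 <= i < j.+1) (b / j.+1%:R) = b.
  by rewrite big_mkord sumr_const card_ord -[LHS]mulr_natr divfK// pnatr_eq0.
have := @expected_max_deviation_ge R p mu d T P n X n_gt0 p012 mup Xmu
  (c * r) j.+1 (fun=> b / j.+1%:R).
rewrite bE (mulrAC c); apply; first by rewrite mulr_ge0// ltW.
move=> i; rewrite ltnS => /pmono pij.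
have pi012 : 0 < p i <= 2^-1 by have := p012 i; lra.
have pi01 : 0 <= p i <= 1 by lra.
have := H n j (p i) n_gt0 pi012 (le_trans pj pij).
have := sum_binomial_pmf n (p i).
rewrite (bigID (fun k : 'I_n.+1 => c * r <= `|k%:R / n%:R - p i|))/=.
set S := (X in X + _ = 1); set S' := (X in _ + X = 1) => SE bS.
(* Each of the [j + 1] coordinates fails to deviate with probability at most [1 - b / (j + 1)]; the
   exponents add up to [b]. *)
apply: le_trans (expR_ge1Dx _).
rewrite -[leLHS]/S' -(addKr S S') SE addrC lerD2l lerN2.
apply: le_trans bS _; rewrite /S big_mkcond [leRHS]big_mkcond/=.
apply: ler_sum => k _; case: ifPn => [h|_]; last first.
  by case: ifP => // _; exact: binomial_pmf_ge0.
rewrite ifT//; apply: le_trans h; rewrite ler_pM2l// /r.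
by rewrite le_min2// le_explicit_rate.
Qed.

(** A single success already gives a deviation of at least [1 / n - p j >= 1 / (2 n)], while no
    success has probability [(1 - p j)^n <= exp (- n p j)]. The other factor 1/2 comes from
    [min1_half_le_onem_expRN]. *)
Lemma expected_max_deviation_ge_sum (R : realType) (n : nat) (p : nat -> R)
    (mu : probability cube R) (d : measure_display) (T : measurableType d)
    (P : probability T R) (X : 'I_n -> {RV P >-> cube}) :
    (0 < n)%N -> (forall j, 0 <= p j <= 2^-1) ->
    product_bernoulli p mu -> iid_sample X mu ->
    (forall j, n%:R * p j <= 2^-1) ->
  forall m, ((4^-1 * Num.min n%:R^-1 (\sum_(0 <= j < m) p j))%:E <=
    expected_max_deviation X p)%E.
Proof.
move=> n_gt0 p012 mup Xmu np m.
have n0 : 0 < n%:R :> R by rewrite ltr0n.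
have nV : 0 < n%:R^-1 :> R by rewrite invr_gt0.
have h := @expected_max_deviation_ge R p mu d T P n X n_gt0 p012 mup Xmu
  (n%:R^-1 / 2) m (fun j => n%:R * p j).
apply: le_trans (h _ _); last 2 first.
- by rewrite divr_ge0// ltW.
- move=> j _; have /andP[pj0 pj1] := p012 j.
  apply: (@le_trans _ _ (binomial_pmf n (p j) 0)).
    rewrite big_mkcond big_ord_recl/= [leRHS](_ : _ = binomial_pmf n (p j) 0 + 0);
      last by rewrite addr0.
    apply: lerD.
      by case: ifP => // _; apply: binomial_pmf_ge0; lra.
    rewrite big1// => i _; rewrite ifF//; apply/negbTE; rewrite negbK.
    rewrite ler_normr; apply/orP; left.
    have : n%:R^-1 <= (bump 0 i)%:R / n%:R :> R.
      by rewrite /bump add1n ler_peMl ?ler1n// ltW.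
    have : p j <= n%:R^-1 / 2.
      by rewrite ler_pdivlMl// -?ler_pdivlMl//.
    lra.
  rewrite /binomial_pmf bin0 expr0 mul1r subn0 mulr1n /unstable.onem.
  rewrite -mulrN expRM_natl; apply: lerXn2r; rewrite ?nnegrE ?expR_ge0//.
    lra.
  exact: expR_ge1Dx.
rewrite lee_fin -mulr_sumr.
set S := \sum_(0 <= j < m) p j.
have S0 : 0 <= S by apply: sumr_ge0 => j _; have := p012 j; lra.
have nS0 : 0 <= n%:R * S by rewrite mulr_ge0// ltW.
have := min1_half_le_onem_expRN nS0.
have -> : Num.min n%:R^-1 S = n%:R^-1 * Num.min 1 (n%:R * S).
  by rewrite minr_pMr ?(ltW nV)// mulr1 mulKf// gt_eqF.
move=> /(ler_wpM2l (ltW nV)); lra.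
Qed.

Theorem theorem1 (R : realType) :
  exists c C : R, 0 < c /\ c <= C /\
  forall (n : nat) (p : nat -> R),
    (0 < n)%N ->
    (forall j : nat, 0 <= p j <= 2^-1) ->
    (forall j : nat, p j.+1 <= p j) ->
  forall (mu : probability cube R) (d : measure_display) (T : measurableType d)
    (P : probability T R) (X : 'I_n -> {RV P >-> cube}),
    product_bernoulli p mu ->
    iid_sample X mu ->
    ((forall j : nat, p j <= (2 * n%:R * j.+1%:R)^-1) ->
      asymp c C (expected_max_deviation X p)
        (mine (n%:R^-1)%:E (\sum_(0 <= j <oo) (p j)%:E)%E))
    /\
    (~ (forall j : nat, p j <= (2 * n%:R * j.+1%:R)^-1) ->
      asymp c C (expected_max_deviation X p)
        (ereal_sup (range (fun j : nat => (phi j.+1 (p j) n)%:E)))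
      /\
      asymp c C (ereal_sup (range (fun j : nat => (phi j.+1 (p j) n)%:E)))
        (mine 1%:E
          (ereal_sup (range (fun j : nat => (explicit_rate j.+1 (p j) n)%:E))))).
Proof.
have [k [k0 lower]] := expected_max_deviation_ge_rate R.
(* The value 1/4 serves the lower bound of regime (i) and the comparison of [phi] with the explicit
   rate; [k / 6] serves the lower bound by [phi]. *)
pose c := Num.min 4^-1 (k / 6).
have c4 : c <= 4^-1 by rewrite /c ge_min lexx.
have ck : c <= k / 6 by rewrite /c ge_min lexx orbT.
have c0 : 0 < c by rewrite lt_min invr_gt0 ltr0n/= divr_gt0.
(* 192 is [3 * 16 * 4]: [3 * 16] from the upper bound by the rate, 4 from the passage to [phi]. *)
exists c, 192; split => //; split; first lra.
move=> n p n_gt0 p012 pdec mu d T P X mup Xmu.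
have {}lower := lower n p n_gt0 p012 pdec mu d T P X mup Xmu.
have n0 : 0 < n%:R :> R by rewrite ltr0n.
have nV : 0 < n%:R^-1 :> R by rewrite invr_gt0.
have p0 j : 0 <= p j by have := p012 j; lra.
have upper := @expected_max_deviation_le_rate R p mu d T P n X n_gt0 p012 mup Xmu.
set D := expected_max_deviation X p in lower upper *.
have D0 : (0 <= D)%E by exact: (@expected_max_deviation_ge0 R p d T P n X n_gt0 p012).
have D1 : (D <= 1)%E by exact: (expected_max_deviation_le1 n_gt0 p012 mup Xmu).
split.
  move=> psmall.
  have np j : n%:R * p j <= 2^-1.
    apply: (le_trans (ler_wpM2l (ltW n0) (psmall j))).
    rewrite (mulrC 2) -mulrA invfM mulrA mulfV ?gt_eqF// mul1r invfM.
    by rewrite ler_piMr// invf_le1 ?ltr0n// ler1n.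
  have S0 : (0 <= \sum_(0 <= j <oo) (p j)%:E)%E.
    by apply: nneseries_ge0 => j _ _; rewrite lee_fin.
  split.
    have low := expected_max_deviation_ge_sum n_gt0 p012 mup Xmu np.
    rewrite -/D in low.
    case: D D0 D1 low {lower upper} => [r| |]// r0 _ low.
    have {}low m : Num.min n%:R^-1 (\sum_(0 <= j < m) p j) <= 4 * r.
      by have := low m; rewrite lee_fin; lra.
    rewrite lee_fin in r0.
    apply: (@le_trans _ _ (c%:E * (4 * r)%:E)%E); last first.
      by rewrite -EFinM lee_fin; have := ler_wpM2r r0 c4; lra.
    apply: lee_wpmul2l; first by rewrite lee_fin ltW.
    (* Either [1 / n] is at most [4 r], or every partial sum is, and then so is the series. *)
    have [nr|nr] := leP n%:R^-1 (4 * r).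
      by rewrite ge_min lee_fin nr.
    rewrite ge_min; apply/orP; right.
    apply: lime_le.
      by apply: is_cvg_nneseries => j _ _; rewrite lee_fin.
    apply: nearW => m; rewrite sumEFin lee_fin.
    by have := low m; rewrite ge_min leNgt nr.
  have DS := expected_max_deviation_le_sum n_gt0 p012 mup Xmu np.
  have Dn : (D <= (3 * (16 * n%:R^-1))%:E)%E.
    apply: upper; first by rewrite mulr_gt0.
    by move=> j; rewrite ler_pM2l// explicit_rate_le_inv.
  rewrite /mine; case: ifP => _.
    by apply: (le_trans Dn); rewrite -EFinM lee_fin; lra.
  by apply: (le_trans DS); apply: lee_wpmul2r => //; rewrite lee_fin; lra.
move=> /existsNP[j0 /negP]; rewrite -ltNge => /ltW pj0.
have phij j := phi_explicit_rate j n_gt0 (p012 j).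
have minr1 j : 0 <= Num.min 1 (explicit_rate j.+1 (p j) n) <= 1.
  by rewrite ge_min lexx/= andbT le_min ler01 explicit_rate_ge0.
have [|y [-> phiy yle]] := @ereal_sup_bounded R (fun j => phi j.+1 (p j) n) 2.
  by move=> j; have [? ? _] := phij j; have := minr1 j; lra.
rewrite mine_ereal_sup; last by move=> j; exact: explicit_rate_ge0.
have [|z [-> ratez zle]] :=
  @ereal_sup_bounded R (fun j => Num.min 1 (explicit_rate j.+1 (p j) n)) 1.
  exact: minr1.
have yz : y <= 2 * z.
  by apply: yle => j; have [_ ? _] := phij j; have := ratez j; lra.
have zy : z <= 4 * y.
  by apply: zle => j; have [_ _ ?] := phij j; have := phiy j; lra.
have z0 : 0 < z.
  apply: lt_le_trans (ratez j0); rewrite lt_min ltr01/=.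
  by apply: lt_le_trans (explicit_rate_ge_inv n_gt0 pj0); rewrite invr_gt0 mulr_gt0.
split; split.
- case: D D0 D1 lower {upper} => [r| |]// r0 _ lower.
  rewrite -EFinM lee_fin.
  have {}lower j : (2 * n%:R * j.+1%:R)^-1 <= p j ->
      k * Num.min 1 (explicit_rate j.+1 (p j) n) <= r.
    by move=> pj; have := lower j pj; rewrite lee_fin.
  (* The index [j0] has rate at least [1 / (3 n)]. This controls the indices with a small parameter,
     whose rates are at most [1 / n]. *)
  have rn : k * n%:R^-1 <= 3 * r.
    apply: (@le_trans _ _ (3 * (k * Num.min 1 (explicit_rate j0.+1 (p j0) n))));
      last by rewrite ler_pM2l// lower.
    have -> : k * n%:R^-1 = 3 * (k * (3 * n%:R)^-1) by field; rewrite gt_eqF.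
    rewrite ler_pM2l// ler_pM2l// le_min explicit_rate_ge_inv// andbT.
    by rewrite invf_le1 ?mulr_gt0// -natrM ler1n muln_gt0.
  have : y <= 6 * r / k.
    apply: yle => j; rewrite ler_pdivlMr//.
    have [_ h _] := phij j.
    have hk : phi j.+1 (p j) n * k <=
        2 * Num.min 1 (explicit_rate j.+1 (p j) n) * k by rewrite ler_pM2r.
    apply: (le_trans hk).
    have [pj|pj] := leP (2 * n%:R * j.+1%:R)^-1 (p j).
      have := lower j pj; have := lower j0 pj0.
      have : 0 <= k * Num.min 1 (explicit_rate j0.+1 (p j0) n).
        by rewrite mulr_ge0 ?(ltW k0)//; have := minr1 j0; lra.
      lra.
    have : Num.min 1 (explicit_rate j.+1 (p j) n) <= n%:R^-1.
      by rewrite ge_min explicit_rate_le_inv ?orbT// ltW.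
    by move/(ler_wpM2l (ltW k0)); lra.
  rewrite ler_pdivlMr// => yr.
  have : c * y <= k / 6 * y by rewrite ler_wpM2r//; lra.
  lra.
(* If [4 y >= 1], the trivial bound by 1 is enough. Otherwise a capped rate at most [4 y < 1] is not
   affected by the cap, so the rate itself is at most [4 y]. *)
- have [y4|y4] := leP 1 (4 * y).
    by apply: (le_trans D1); rewrite -EFinM lee_fin; lra.
  have -> : (192%:E * y%:E)%E = (3 * (16 * (4 * y)))%:E.
    by rewrite -EFinM; congr EFin; ring.
  apply: upper; first lra.
  move=> j; rewrite ler_pM2l//.
  have : Num.min 1 (explicit_rate j.+1 (p j) n) <= 4 * y.
    by apply: le_trans zy; exact: ratez.
  by rewrite ge_min leNgt y4.
- by rewrite -EFinM lee_fin; have := ler_wpM2r (ltW z0) c4; lra.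
- by rewrite -EFinM lee_fin; lra.
Qed.
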